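(* Let $\epsilon>0$, $p(\rho)=\rho^\gamma$ with $\gamma>1$, and let $(\rho,\mathbf v,w)$, $\mathbf u=(\mathbf v,w)$, be a dissipative weak solution on $(0,T)$ of the scaled compressible Navier-Stokes system (CNS). Let $r=r(t,x)>0$ and $\mathbf U=(\mathbf V,W)$ be smooth test functions on $[0,T]\times\Omega$ (periodic in $x$ and $z$), with $r$ independent of $z$. Then for a.a. $\tau\in(0,T)$ the relative entropy inequality holds: $$\begin{aligned} &\mathcal{E}(\rho,\mathbf{u}|r,\mathbf U)\Big|^{t=\tau}_{t=0}+\int^\tau_0\int_\Omega\big(\nabla\mathbf v:(\nabla\mathbf v-\nabla\mathbf V)+\epsilon^2|\nabla w|^2\big)\,dxdzdt\\ &\quad\leq\int^\tau_0\int_{\Omega}\rho(\partial_t\mathbf V+\mathbf v\cdot\nabla_x\mathbf V+w\partial_z\mathbf V)\cdot(\mathbf V-\mathbf v)\,dxdzdt\\ &\qquad+\epsilon^2\int^\tau_0\int_{\Omega}\rho(\partial_tW+\mathbf v\cdot\nabla_xW+w\partial_zW)(W-w)\,dxdzdt+\epsilon^2\int^\tau_0\int_\Omega\nabla w\cdot\nabla W\,dxdzdt\\ &\qquad-\int^\tau_0\int_{\Omega}P''(r)\big((\rho-r)\partial_tr+\rho\mathbf v\cdot\nabla_xr\big)\,dxdzdt-\int^\tau_0\int_{\Omega}p(\rho)\,\mathrm{div}_x\mathbf V\,dxdzdt . \end{aligned}$$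
   Context: **Domain and notation.** $\Omega=\mathbb T^2\times(-1,1)$, with points $(x,z)$, $x\in\mathbb T^2$ horizontal and $z$ vertical. All functions are periodic in $x$ and in $z$, so in $C^\infty_c([0,T)\times\Omega)$ the domain $\Omega$ is understood with periodicity in all variables. Velocities are written $\mathbf u=(\mathbf v,w)$ with $\mathbf v\in\mathbb R^2$ (horizontal) and $w\in\mathbb R$ (vertical). $\nabla=(\nabla_x,\partial_z)$, $\mathrm{div}\,\mathbf u=\mathrm{div}_x\mathbf v+\partial_zw$, $\Delta_x$ is the horizontal Laplacian. The pressure is $p(\rho)=\rho^\gamma$, and $P(\rho)=\rho\int_1^\rho\frac{p(s)}{s^2}\,ds$, so $rP'(r)-P(r)=p(r)$. All densities are assumed independent of $z$. **Scaled compressible Navier-Stokes system (CNS).** $$\partial_t\rho+\mathrm{div}_x(\rho\mathbf v)+\partial_z(\rho w)=0,$$ $$\rho\partial_t\mathbf v+\rho(\mathbf u\cdot\nabla)\mathbf v-\Delta_x\mathbf v-\partial_{zz}\mathbf v+\nabla_xp(\rho)=0,$$ $$\epsilon^2(\rho\partial_tw+\rho\mathbf u\cdot\nabla w-\Delta_xw-\partial_{zz}w)+\partial_zp(\rho)=0.$$ **Dissipative (finite energy) weak solution of CNS on $(0,T)$.** $(\rho,\mathbf u)$ with $\rho=\rho(x,t)$ (nonnegative), $$\mathbf u\in L^2(0,T;H^1(\Omega)),\quad \rho|\mathbf u|^2\in L^\infty(0,T;L^1(\Omega)),\quad \rho\in L^\infty(0,T;L^\gamma(\Omega))\cap C([0,T],L^1(\Omega)),$$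 attaining the prescribed initial data $(\rho_0,\mathbf u_0)$ at $t=0$, such that: (i) for all $\psi\in C_c^\infty([0,T)\times\Omega)$, $$\Big[\int_\Omega\rho\psi\,dxdz\Big]_{t=0}^{t=\tau}=\int_0^\tau\int_\Omega\rho\partial_t\psi+\rho\mathbf v\cdot\nabla_x\psi+\rho w\partial_z\psi\,dxdzdt;$$ (ii) for all $\varphi_H$ ($\mathbb R^2$-valued) and $\varphi_3$ (scalar) in $C_c^\infty([0,T)\times\Omega)$, $$\Big[\int_\Omega\rho\mathbf v\cdot\varphi_H\Big]_{0}^{\tau}-\int_0^\tau\!\!\int_\Omega\rho\mathbf v\cdot\partial_t\varphi_H-\int_0^\tau\!\!\int_\Omega\big(\rho\mathbf v\otimes\mathbf v:\nabla_x\varphi_H+\rho w\mathbf v\cdot\partial_z\varphi_H\big)+\int_0^\tau\!\!\int_\Omega\nabla\mathbf v:\nabla\varphi_H-\int_0^\tau\!\!\int_\Omega p(\rho)\mathrm{div}_x\varphi_H=0,$$ $$\epsilon^2\Big[\int_\Omega\rho w\varphi_3\Big]_{0}^{\tau}-\epsilon^2\int_0^\tau\!\!\int_\Omega\rho w\partial_t\varphi_3-\epsilon^2\int_0^\tau\!\!\int_\Omega\rho w\mathbf u\cdot\nabla\varphi_3+\epsilon^2\int_0^\tau\!\!\int_\Omega\nabla w\cdot\nabla\varphi_3-\int_0^\tau\!\!\int_\Omega p(\rho)\partial_z\varphi_3=0;$$ (iii) for a.a. $\tau\in(0,T)$, $$\Big[\int_\Omega\tfrac12\rho|\mathbf v|^2+\tfrac{\epsilon^2}2\rho|w|^2+P(\rho)\,dxdz\Big]_{t=0}^{t=\tau}+\int_0^\tau\int_\Omega(|\nabla\mathbf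 v|^2+\epsilon^2|\nabla w|^2)\,dxdzdt\le0.$$ **Relative energy functional.** At each time, $$\mathcal E(\rho,\mathbf u\,|\,r,\mathbf U)=\int_\Omega\Big[\tfrac12\rho|\mathbf v-\mathbf V|^2+\tfrac{\epsilon^2}2\rho|w-W|^2+P(\rho)-P'(r)(\rho-r)-P(r)\Big]dxdz.$$ *)

(* Defs.v *)
From HB Require Import structures.
From mathcomp Require Import all_boot all_order all_algebra.
From mathcomp Require Import all_classical all_reals all_analysis.

Set Implicit Arguments.
Unset Strict Implicit.
Unset Printing Implicit Defensive.

Import Order.TTheory GRing.Theory Num.Theory.
Import numFieldNormedType.Exports.

Local Open Scope classical_set_scope.
Local Open Scope ring_scope.

(* Points of space are triples ((x1, x2), z); points of space-time are pairs
   (t, ((x1, x2), z)).  Functions on Omega = T^2 x (-1,1) that are periodic in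
   all variables are functions on R^3 with period 1 in x1 and x2 and period 2
   in z, and integrals over Omega are taken over one period cell. *)
Notation space3 R := (R * R * R)%type.
Notation spacetime R := (R * (R * R * R))%type.

Definition Omega (R : realType) : set (space3 R) :=
  (`[0, 1[ `*` `[0, 1[) `*` `]-1, 1[.

Definition cylinder (R : realType) (I : set R) : set (spacetime R) :=
  I `*` @Omega R.

Lemma sigma_finite_product d1 d2 (T1 : measurableType d1)
    (T2 : measurableType d2) (R : realType)
    (m1 : {sigma_finite_measure set T1 -> \bar R})
    (m2 : {sigma_finite_measure set T2 -> \bar R}) :
  sigma_finite setT (m1 \x m2)%E.
Proof.
have /sigma_finiteP[F [TF ndF Foo]] := sigma_finiteT m1.
have /sigma_finiteP[G [TG ndG Goo]] := sigma_finiteT m2.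
exists (fun n => F n `*` G n).
  rewrite -setXTT TF TG predeqE => -[x y]; split.
    move=> [/= [n _ Fnx] [k _ Gky]]; exists (maxn n k) => //; split.
    - by move: x Fnx; exact/subsetPset/ndF/leq_maxl.
    - by move: y Gky; exact/subsetPset/ndG/leq_maxr.
  by move=> [n _ []/= ? ?]; split; exists n.
move=> k; have [? ?] := Foo k; have [? ?] := Goo k.
split; first exact: measurableX.
by rewrite product_measure1E// lte_mul_pinfty// ge0_fin_numE.
Qed.

(* The library's sigma-finiteness instance for products is shadowed by the one
   for probabilities, hence these named measures with their own instances. *)
Definition mu_plane (R : realType) :=
  (@lebesgue_measure R \x @lebesgue_measure R)%E.
HB.instance Definition _ (R : realType) := Measure.on (@mu_plane R).
HB.instance Definition _ (R : realType) :=
  Measure_isSigmaFinite.Build _ _ _ (@mu_plane R)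
    (sigma_finite_product (@lebesgue_measure R) (@lebesgue_measure R)).

Definition mu_space (R : realType) := (@mu_plane R \x @lebesgue_measure R)%E.
HB.instance Definition _ (R : realType) := Measure.on (@mu_space R).
HB.instance Definition _ (R : realType) :=
  Measure_isSigmaFinite.Build _ _ _ (@mu_space R)
    (sigma_finite_product (@mu_plane R) (@lebesgue_measure R)).

Definition mu_spacetime (R : realType) :=
  (@lebesgue_measure R \x @mu_space R)%E.
HB.instance Definition _ (R : realType) := Measure.on (@mu_spacetime R).
HB.instance Definition _ (R : realType) :=
  Measure_isSigmaFinite.Build _ _ _ (@mu_spacetime R)
    (sigma_finite_product (@lebesgue_measure R) (@mu_space R)).

Definition slice (R : realType) (f : spacetime R -> R) (t : R) : space3 R -> R :=
  fun q => f (t, q).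

(* \int_Omega f(t) dx dz *)
Definition int_Omega (R : realType) (f : spacetime R -> R) (t : R) : R :=
  (\int[@mu_space R]_(q in @Omega R) slice f t q)%R.

(* [ \int_Omega f dx dz ]_{t=0}^{t=tau} *)
Definition bracket (R : realType) (f : spacetime R -> R) (tau : R) : R :=
  int_Omega f tau - int_Omega f 0.

(* \int_0^tau \int_Omega f dx dz dt *)
Definition int_cyl (R : realType) (f : spacetime R -> R) (tau : R) : R :=
  (\int[@mu_spacetime R]_(a in cylinder `]0, tau[) f a)%R.

Definition ae_time (R : realType) (T : R) (P : R -> Prop) : Prop :=
  {ae @lebesgue_measure R, forall t, t \in `]0, T[ -> P t}.

(* Spatial directions: ord_max is the vertical one, the two others are the
   horizontal ones. *)
Definition horizontal (i : 'I_2) : 'I_3 := widen_ord (leqnSn 2) i.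

Definition vertical : 'I_3 := ord_max.

Definition dir (R : realType) (j : 'I_3) : space3 R :=
  ((j == 0 :> nat)%:R, (j == 1 :> nat)%:R, (j == 2 :> nat)%:R).

Definition dt (R : realType) (f : spacetime R -> R) : spacetime R -> R :=
  'D_(1, 0) f.

Definition ds (R : realType) (j : 'I_3) (f : spacetime R -> R) :
    spacetime R -> R :=
  'D_(0, dir R j) f.

Definition dx (R : realType) (i : 'I_2) (f : spacetime R -> R) :
    spacetime R -> R :=
  ds (horizontal i) f.

Definition dz (R : realType) (f : spacetime R -> R) : spacetime R -> R :=
  ds vertical f.

Definition div_x (R : realType) (f : 'I_2 -> spacetime R -> R) :
    spacetime R -> R :=
  fun a => \sum_(i < 2) dx i (f i) a.

Fixpoint is_Ck (R : realType) (E : normedModType R) (k : nat) (f : E -> R) :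
    Prop :=
  match k with
  | 0 => continuous f
  | k'.+1 => continuous f /\
             forall e : E, (forall a, derivable f a e) /\ is_Ck k' ('D_e f)
  end.

Definition smooth (R : realType) (E : normedModType R) (f : E -> R) : Prop :=
  forall k, is_Ck k f.

Definition periodic (R : realType) (f : space3 R -> R) : Prop :=
  forall x1 x2 z,
    [/\ f (x1 + 1, x2, z) = f (x1, x2, z),
        f (x1, x2 + 1, z) = f (x1, x2, z) &
        f (x1, x2, z + 2) = f (x1, x2, z)].

Definition periodic_st (R : realType) (f : spacetime R -> R) : Prop :=
  forall t, periodic (slice f t).

Definition z_independent (R : realType) (f : spacetime R -> R) : Prop :=
  forall t x1 x2 z z', f (t, (x1, x2, z)) = f (t, (x1, x2, z')).

(* C^infty([0,T] x Omega): a function that is smooth up to t = 0 and t = T is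
   the restriction of a smooth function defined for all t, so test functions
   are taken on the whole time line. *)
Definition smooth_periodic (R : realType) (f : spacetime R -> R) : Prop :=
  smooth f /\ periodic_st f.

(* C_c^infty([0,T) x Omega): the periodic cell being compact, compactness of
   the support only means vanishing near t = T. *)
Definition test_function (R : realType) (T : R) (f : spacetime R -> R) : Prop :=
  smooth_periodic f /\
  exists2 T' : R, T' < T & forall t q, T' <= t -> f (t, q) = 0.

Definition integrable_Omega (R : realType) (f : space3 R -> R) : Prop :=
  (@mu_space R).-integrable (@Omega R) (EFin \o f).

(* f is in the periodic H^1(Omega) and its weak gradient is G *)
Definition in_H1 (R : realType) (f : space3 R -> R) (G : 'I_3 -> space3 R -> R) :
    Prop :=
  [/\ measurable_fun (@Omega R) f,
      (forall j, measurable_fun (@Omega R) (G j)),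
      integrable_Omega (fun q => f q ^+ 2),
      (forall j, integrable_Omega (fun q => G j q ^+ 2)) &
      forall phi : space3 R -> R, smooth phi -> periodic phi -> forall j,
        (\int[@mu_space R]_(q in @Omega R) (f q * 'D_(dir R j) phi q))%R =
        - (\int[@mu_space R]_(q in @Omega R) (G j q * phi q))%R].

(* f is in L^2(0,T; H^1(Omega)) with weak (spatial) gradient G *)
Definition in_L2H1 (R : realType) (T : R) (f : spacetime R -> R)
    (G : 'I_3 -> spacetime R -> R) : Prop :=
  [/\ measurable_fun (cylinder `]0, T[) f,
      (forall j, measurable_fun (cylinder `]0, T[) (G j)),
      ae_time T (fun t => in_H1 (slice f t) (fun j => slice (G j) t)) &
      (@mu_spacetime R).-integrable (cylinder `]0, T[)
        (EFin \o (fun a => f a ^+ 2 + \sum_(j < 3) G j a ^+ 2))].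

(* f is in L^infty(0,T; L^p(Omega)), for 1 <= p < oo *)
Definition in_Linf_Lp (R : realType) (T p : R) (f : spacetime R -> R) : Prop :=
  measurable_fun (cylinder `]0, T[) f /\
  exists C : R, ae_time T (fun t =>
    (\int[@mu_space R]_(q in @Omega R) (`|slice f t q| `^ p)%:E <= C%:E)%E).

(* f is in C([0,T]; L^1(Omega)) *)
Definition in_C_L1 (R : realType) (T : R) (f : spacetime R -> R) : Prop :=
  (forall t, t \in `[0, T] -> integrable_Omega (slice f t)) /\
  (forall t, t \in `[0, T] ->
    (fun s => (\int[@mu_space R]_(q in @Omega R)
                 `|slice f s q - slice f t q|)%R)
      @ within `[0, T] (nbhs t) --> (0 : R)).

Definition pressure (R : realType) (gamma s : R) : R := s `^ gamma.

(* \int_a^b g(s) ds, for either order of the endpoints *)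
Definition oriented_int (R : realType) (g : R -> R) (a b : R) : R :=
  if a <= b then (\int[@lebesgue_measure R]_(s in `[a, b]) g s)%R
  else - (\int[@lebesgue_measure R]_(s in `[b, a]) g s)%R.

Definition potential (R : realType) (gamma s : R) : R :=
  s * oriented_int (fun y => pressure gamma y / y ^+ 2) 1 s.

Record dissipative_weak_solution (R : realType) (gamma epsilon T : R)
    (rho : spacetime R -> R) (v : 'I_2 -> spacetime R -> R)
    (w : spacetime R -> R)
    (* weak spatial gradients of v and w *)
    (Gv : 'I_2 -> 'I_3 -> spacetime R -> R) (Gw : 'I_3 -> spacetime R -> R)
    (* initial data *)
    (rho0 : space3 R -> R) (v0 : 'I_2 -> space3 R -> R) (w0 : space3 R -> R) :
    Prop := {
  dws_rho_z : z_independent rho;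
  dws_rho_per : periodic_st rho;
  dws_v_per : forall i, periodic_st (v i);
  dws_w_per : periodic_st w;
  dws_rho_ge0 : forall t q, t \in `[0, T] -> 0 <= rho (t, q);
  dws_v_H1 : forall i, in_L2H1 T (v i) (Gv i);
  dws_w_H1 : in_L2H1 T w Gw;
  dws_kinetic : in_Linf_Lp T 1
    (fun a => rho a * (\sum_(i < 2) v i a ^+ 2 + w a ^+ 2));
  dws_rho_Lgamma : in_Linf_Lp T gamma rho;
  dws_rho_C : in_C_L1 T rho;
  (* The fields at t = 0 are the initial data, which have finite energy. *)
  dws_rho_init :
    {ae @mu_space R, forall q, q \in @Omega R -> rho (0, q) = rho0 q};
  dws_v_init : forall i,
    {ae @mu_space R, forall q, q \in @Omega R -> v i (0, q) = v0 i q};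
  dws_w_init :
    {ae @mu_space R, forall q, q \in @Omega R -> w (0, q) = w0 q};
  dws_v_init_meas : forall i, measurable_fun (@Omega R) (slice (v i) 0);
  dws_w_init_meas : measurable_fun (@Omega R) (slice w 0);
  dws_kinetic_init : integrable_Omega
    (slice (fun a => rho a * (\sum_(i < 2) v i a ^+ 2 + w a ^+ 2)) 0);
  dws_rho_init_Lgamma : integrable_Omega (slice (fun a => rho a `^ gamma) 0);
  dws_continuity : forall psi, test_function T psi ->
    ae_time T (fun tau =>
      bracket (fun a => rho a * psi a) tau =
      int_cyl (fun a => rho a * dt psi a
                        + rho a * (\sum_(i < 2) v i a * dx i psi a)
                        + rho a * w a * dz psi a) tau);
  dws_momentum_h : forall phi : 'I_2 -> spacetime R -> R,
    (forall i, test_function T (phi i)) ->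
    ae_time T (fun tau =>
      bracket (fun a => rho a * (\sum_(i < 2) v i a * phi i a)) tau
      - int_cyl (fun a => rho a * (\sum_(i < 2) v i a * dt (phi i) a)) tau
      - int_cyl (fun a =>
          rho a * (\sum_(i < 2) \sum_(j < 2) v i a * v j a * dx j (phi i) a)
          + rho a * w a * (\sum_(i < 2) v i a * dz (phi i) a)) tau
      + int_cyl (fun a =>
          \sum_(i < 2) \sum_(j < 3) Gv i j a * ds j (phi i) a) tau
      - int_cyl (fun a => pressure gamma (rho a) * div_x phi a) tau
      = 0);
  dws_momentum_v : forall phi, test_function T phi ->
    ae_time T (fun tau =>
      epsilon ^+ 2 * bracket (fun a => rho a * w a * phi a) tau
      - epsilon ^+ 2 * int_cyl (fun a => rho a * w a * dt phi a) tau
      - epsilon ^+ 2 * int_cyl (fun a =>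
          rho a * w a * (\sum_(i < 2) v i a * dx i phi a + w a * dz phi a)) tau
      + epsilon ^+ 2 * int_cyl (fun a =>
          \sum_(j < 3) Gw j a * ds j phi a) tau
      - int_cyl (fun a => pressure gamma (rho a) * dz phi a) tau
      = 0);
  dws_energy : ae_time T (fun tau =>
    bracket (fun a =>
        2^-1 * rho a * (\sum_(i < 2) v i a ^+ 2)
        + epsilon ^+ 2 / 2 * rho a * w a ^+ 2
        + potential gamma (rho a)) tau
    + int_cyl (fun a =>
        \sum_(i < 2) \sum_(j < 3) Gv i j a ^+ 2
        + epsilon ^+ 2 * (\sum_(j < 3) Gw j a ^+ 2)) tau
    <= 0)
}.

Definition relative_energy_density (R : realType) (gamma epsilon : R)
    (rho : spacetime R -> R) (v : 'I_2 -> spacetime R -> R)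
    (w : spacetime R -> R)
    (r : spacetime R -> R) (V : 'I_2 -> spacetime R -> R)
    (W : spacetime R -> R) : spacetime R -> R :=
  fun a =>
    2^-1 * rho a * (\sum_(i < 2) (v i a - V i a) ^+ 2)
    + epsilon ^+ 2 / 2 * rho a * (w a - W a) ^+ 2
    + (potential gamma (rho a)
       - derive1 (potential gamma) (r a) * (rho a - r a)
       - potential gamma (r a)).

Definition relative_energy (R : realType) (gamma epsilon : R)
    (rho : spacetime R -> R) (v : 'I_2 -> spacetime R -> R)
    (w : spacetime R -> R)
    (r : spacetime R -> R) (V : 'I_2 -> spacetime R -> R)
    (W : spacetime R -> R) (t : R) : R :=
  int_Omega (relative_energy_density gamma epsilon rho v w r V W) t.

(* d_t f + v . grad_x f + w d_z f *)
Definition material (R : realType) (v : 'I_2 -> spacetime R -> R)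
    (w f : spacetime R -> R) : spacetime R -> R :=
  fun a => dt f a + \sum_(i < 2) v i a * dx i f a + w a * dz f a.

(* Main.v *)
Require Import Defs.
From mathcomp Require Import all_boot all_order all_algebra.
From mathcomp Require Import all_classical all_reals all_analysis.
From mathcomp Require Import measurable_realfun ring lra.
Import Order.TTheory GRing.Theory Num.Theory.
Import numFieldNormedType.Exports.

Set Implicit Arguments.
Unset Strict Implicit.
Unset Printing Implicit Defensive.

Local Open Scope classical_set_scope.
Local Open Scope ring_scope.

(* Test the momentum equations with V and W and the continuity equation with
   |V|^2/2 + epsilon^2 W^2/2 - P'(r), and add the results to the energy
   inequality; since r P'(r) - P(r) = r^gamma, the only remaining part of the
   relative energy is the time increment of the integral of r^gamma, given by
   the fundamental theorem of calculus.  The vertical pressure term vanishes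
   because rho does not depend on z and W is periodic in z.

   V, W and P'(r) are not admissible test functions as they stand.  A smooth
   time cutoff equal to 1 up to a time beyond tau makes them vanish near T, at
   the price of a countable family of null sets of times; and r, which is
   positive on [0,T] only, is replaced there by a smooth positive function that
   agrees with it above its minimum on the compact cylinder.  All products of
   fields are integrable because 1, the velocities and smooth functions belong
   to L^2 with weight rho. *)

(** Expanding the squares in the relative energy leaves the energy of the solution, terms linear in
    [rho], [rho v] and [rho w] with smooth coefficients, and a smooth function of [r]. Hence no
    nonlinear function of the weak solution is ever differentiated: the energy inequality supplies
    the quadratic terms, each linear term is the bracket of one weak equation, and the coefficient
    of [rho] dictates the test function of the continuity equation. Since [p'(r) = r P''(r)], the
    time derivative of [r^gamma] is [r P''(r) dt r]; this is where the [r] in the factor [rho - r]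
    of the result comes from. What remains is a pointwise polynomial identity. Most of the work is
    integrability, without which the integrals can be neither split nor added. Time 0 is treated
    separately: it is a single instant, which statements for almost every time do not reach, and
    there the finite energy of the initial data takes over. *)

(** * Calculus of C^k functions through iterated directional derivatives *)

Section Ck_calculus.
Context {R : realType} {E : normedModType R}.
Implicit Types (f g : E -> R) (phi : R -> R) (k : nat).

Lemma derive_line f a (e : E) :
  'D_e f a = 'D_1 (fun h : R => f (h *: e + a)) 0.
Proof.
rewrite /derive; set g1 := fun h => h^-1 *: _; set g2 := fun h => h^-1 *: _.
suff -> : g1 = g2 by [].
by apply/funext => h; rewrite /g1 /g2 /= addr0 scale0r add0r [_%:A]mulr1.
Qed.

(** Only a directional derivative of [f] is given, not a differential, so the chain rule is applied
    to the restriction of [f] to the line through [a] in direction [e], a function of one real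
    variable. *)
Lemma is_derive_comp_line f phi a (e : E) (df dphi : R) :
  is_derive a e f df -> is_derive (f a) 1 phi dphi ->
  is_derive a e (phi \o f) (dphi * df).
Proof.
move=> [fa faE] hphi.
have h0 : (fun h : R => f (h *: e + a)) 0 = f a by rewrite scale0r add0r.
have dl : is_derive (0 : R) 1 (fun h : R => f (h *: e + a)) df.
  by split; [move/derivable1P : fa|rewrite -derive_line].
have dl2 : is_derive ((fun h : R => f (h *: e + a)) 0) 1 phi dphi by rewrite h0.
have [d1 d2] := is_derive1_comp dl2 dl.
by split; [exact/derivable1P|rewrite derive_line].
Qed.

Lemma is_CkW k f : is_Ck k.+1 f -> is_Ck k f.
Proof.
elim: k f => [|k IH] f; first by case.
by move=> -[cf df]; split=> // e; have [de /IH] := df e.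
Qed.

Lemma is_Ck_cst k (c : R) : is_Ck k (cst c : E -> R).
Proof.
elim: k c => [|k IH] c /=; first exact: cst_continuous.
split; [exact: cst_continuous|move=> e]; split=> //.
have -> : 'D_e (cst c : E -> R) = cst 0 by apply/funext => a; rewrite derive_cst.
exact: IH.
Qed.

Lemma is_CkD k f g : is_Ck k f -> is_Ck k g -> is_Ck k (f \+ g).
Proof.
elim: k f g => [|k IH] f g /=;
  first by move=> cf cg a; apply: cvgD; [exact: cf|exact: cg].
move=> -[cf df] [cg dg]; split=> [a|e]; first by apply: cvgD; [exact: cf|exact: cg].
have [fe fC] := df e; have [ge gC] := dg e.
split=> [a|]; first exact: derivableD.
have -> : 'D_e (f \+ g) = 'D_e f \+ 'D_e g by apply/funext => a; rewrite deriveD.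
exact: IH.
Qed.

Lemma is_CkM k f g : is_Ck k f -> is_Ck k g -> is_Ck k (f \* g).
Proof.
elim: k f g => [|k IH] f g.
  by move=> cf cg a; apply: cvgM; [exact: cf|exact: cg].
move=> Cf Cg; have /= [cf df] := Cf; have /= [cg dg] := Cg.
split=> [a|e]; first by apply: cvgM; [exact: cf|exact: cg].
have [fe fC] := df e; have [ge gC] := dg e.
split=> [a|]; first exact: derivableM.
have -> : 'D_e (f \* g) = (f \* 'D_e g) \+ (g \* 'D_e f).
  by apply/funext => a; rewrite deriveM.
by apply: is_CkD; apply: IH => //; exact: is_CkW.
Qed.

Lemma is_Ck_comp k phi f : is_Ck k phi -> is_Ck k f -> is_Ck k (phi \o f).
Proof.
elim: k phi f => [|k IH] phi f.
  by move=> cp cf a; apply: continuous_comp; [exact: cf|exact: cp].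
move=> Cp Cf; have /= [cp dp] := Cp; have /= [cf df] := Cf.
split=> [a|e]; first by apply: continuous_comp; [exact: cf|exact: cp].
have [fe fC] := df e; have [pe pC] := dp 1.
have D a : is_derive a e (phi \o f) ('D_1 phi (f a) * 'D_e f a).
  by apply: is_derive_comp_line; exact/derivableP.
split=> [a|]; first by case: (D a).
have -> : 'D_e (phi \o f) = ('D_1 phi \o f) \* 'D_e f.
  by apply/funext => a; case: (D a) => _ ->.
by apply: is_CkM => //; apply: IH => //; exact: is_CkW.
Qed.

Lemma is_derive_powR_line f (x : R) a (e : E) : 0 < f a -> derivable f a e ->
  is_derive a e (fun b => f b `^ x) (x * f a `^ (x - 1) * 'D_e f a).
Proof.
move=> fa0 fe.
exact: (is_derive_comp_line (derivableP fe) (is_derive1_powR x fa0)).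
Qed.

Lemma is_Ck_powR k f (x : R) : (forall a, 0 < f a) -> is_Ck k f ->
  is_Ck k (fun a => f a `^ x).
Proof.
move=> f0.
have cpow y : continuous f -> continuous (fun a => f a `^ y).
  move=> cf a.
  suff c : {for f a, continuous (fun s : R => s `^ y)} by exact: continuous_comp (cf a) c.
  apply/differentiable_continuous/derivable1_diffP.
  by have [] := is_derive1_powR y (f0 a).
(* The exponent is generalized because differentiation lowers it by one. *)
elim: k x => [|k IH] x Cf; first exact: cpow.
have /= [cf df] := Cf; split=> [|e]; first exact: cpow.
have [fe fC] := df e.
have D a := is_derive_powR_line x (f0 a) (fe a).
split=> [a|]; first by case: (D a).
have -> : 'D_e (fun a => f a `^ x) = (cst x \* (fun a => f a `^ (x - 1))) \* 'D_e f.
  by apply/funext => a; case: (D a) => _ ->.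
apply: is_CkM => //; apply: is_CkM; first exact: is_Ck_cst.
by apply: IH; exact: is_CkW.
Qed.

Lemma is_Ck_linear k (f : {linear E -> R}) : continuous f -> is_Ck k f.
Proof.
move=> cf; case: k => [|k] //; split=> // e.
have D a : is_derive a e f (f e).
  have df : differentiable f a by exact: linear_differentiable.
  by split; [exact: diff_derivable|rewrite deriveE// diff_lin].
split=> [a|]; first by case: (D a).
have -> : 'D_e f = cst (f e) by apply/funext => a; case: (D a) => _ ->.
exact: is_Ck_cst.
Qed.

End Ck_calculus.

(** * Closure properties of smooth functions *)

Section smooth.
Context {R : realType} {E : normedModType R}.
Implicit Types (f g : E -> R).

Lemma smooth_derive f (e : E) : smooth f -> smooth ('D_e f).
Proof. by move=> sf k; have [_ /(_ e)[]] := sf k.+1. Qed.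

Lemma smooth_derivable f a (e : E) : smooth f -> derivable f a e.
Proof. by move=> /(_ 1%N)[_ /(_ e)[]]. Qed.

Lemma smooth_continuous f : smooth f -> continuous f.
Proof. by move=> /(_ 0%N). Qed.

Lemma smooth_cst (c : R) : smooth (cst c : E -> R).
Proof. by move=> k; exact: is_Ck_cst. Qed.

Lemma smoothD f g : smooth f -> smooth g -> smooth (f \+ g).
Proof. by move=> sf sg k; exact: is_CkD. Qed.

Lemma smoothM f g : smooth f -> smooth g -> smooth (f \* g).
Proof. by move=> sf sg k; exact: is_CkM. Qed.

Lemma smooth_comp (phi : R -> R) f : smooth phi -> smooth f -> smooth (phi \o f).
Proof. by move=> sf sg k; exact: is_Ck_comp. Qed.

Lemma smooth_powR f (x : R) : (forall a, 0 < f a) -> smooth f ->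
  smooth (fun a => f a `^ x).
Proof. by move=> f0 sf k; exact: is_Ck_powR. Qed.

Lemma smooth_sum n (F : 'I_n -> E -> R) :
  (forall i, smooth (F i)) -> smooth (fun a => \sum_(i < n) F i a).
Proof.
elim: n F => [|n IH] F sF.
  under eq_fun do rewrite big_ord0; exact: smooth_cst.
under eq_fun do rewrite big_ord_recr/=.
by apply: smoothD => //; exact: IH.
Qed.

End smooth.

(** * Smooth steps and positive clippings on the real line *)

Section flat.
Context {R : realType}.

(* [flat 0] vanishes to infinite order at 0; the powers of [x^-1] make the
   family stable under differentiation. *)
Definition flat (n : nat) (x : R) : R :=
  if 0 < x then x^-1 ^+ n * expR (- x^-1) else 0.

Lemma flat_ge0 n x : 0 <= flat n x.
Proof.
rewrite /flat; case: ifPn => // x0.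
by rewrite mulr_ge0 ?expR_ge0// exprn_ge0// invr_ge0 ltW.
Qed.

(** The term of degree n+3 in the exponential series of [x^-1] bounds [expR x^-1] from below: n of
    its powers cancel [x^-n] and three are left over. One of them absorbs the division by the
    increment in the difference quotient at 0, the other two make it tend to 0. *)
Lemma flat_le_sqr n x : flat n x <= (n.+3)`!%:R * (x ^+ 2 * `|x|).
Proof.
rewrite /flat; case: ifPn => [x0|_]; last first.
  by rewrite mulr_ge0// mulr_ge0// exprn_even_ge0.
rewrite (gtr0_norm x0) expRN ler_pdivrMr ?expR_gt0//.
have /(le_trans _) : 1 + x^-1 ^+ n.+3 / n.+3`!%:R <= expR x^-1.
  by apply: expR_ge1Dxn; rewrite invr_ge0 ltW.
move=> /(_ (x^-1 ^+ n.+3 / n.+3`!%:R)) H.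
have {}H : x^-1 ^+ n.+3 / n.+3`!%:R <= expR x^-1 by apply: H; rewrite lerDr.
rewrite -[leLHS]mulr1.
have -> : x^-1 ^+ n * 1 =
    (n.+3)`!%:R * (x ^+ 2 * x) * (x^-1 ^+ n.+3 / n.+3`!%:R).
  have n0 : (n.+3)`!%:R != 0 :> R by rewrite pnatr_eq0 -lt0n fact_gt0.
  by rewrite !exprS; field; rewrite n0 gt_eqF.
by rewrite ler_wpM2l// mulr_ge0// mulr_ge0// ?sqr_ge0// ltW.
Qed.

Lemma is_derive_flat n (x : R) :
  is_derive x 1 (flat n) (- n%:R * flat n.+1 x + flat n.+2 x).
Proof.
have [x0|x0|x0] := ltgtP x 0.
- have E : \near x, cst 0 x = flat n x.
    near=> y; rewrite /flat ltNge ltW//=; near: y; exact: lt_nbhsl.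
  apply: (near_eq_is_derive E); rewrite /flat !ltNge !(ltW x0)/= mulr0 addr0.
  exact: is_derive_cst.
- have E : \near x, (x^-1 ^+ n * expR (- x^-1)) = flat n x.
    near=> y; rewrite /flat ifT//; near: y; exact: lt_nbhsr.
  apply: (near_eq_is_derive E); rewrite /flat x0.
  have dV : is_derive x 1 (fun y : R => y^-1) (- x ^- 2).
    split; first by apply: derivableV => //; rewrite gt_eqF.
    rewrite (@deriveV _ _ id)//= ?gt_eqF// derive_id; by rewrite [_ *: 1]mulr1.
  have dE : is_derive x 1 (fun y => expR (- y^-1)) (expR (- x^-1) * - - x ^- 2).
    exact: (@is_derive1_comp _ expR (fun y => - y^-1)).
  have D := is_deriveM (is_deriveX n dV) dE.
  rewrite exprfctE in D; apply: (is_derive_eq D).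
  rewrite !exprS; case: n {E D} => [|n] /=; rewrite /GRing.scale/=; first by field; rewrite gt_eqF.
  rewrite !exprS -mulr_natl; field; rewrite gt_eqF//.
- rewrite x0.
  have f0 m : flat m 0 = 0 by rewrite /flat ltxx.
  rewrite !f0 mulr0 addr0.
  suff H : (fun h : R => h^-1 *: (flat n (h *: 1 + 0) - flat n 0)) @ 0^' --> (0 : R).
    by split; [apply/cvg_ex; exists 0|exact/cvg_lim].
  rewrite f0; under eq_fun do rewrite subr0 addr0 [_ *: 1]mulr1.
  apply/cvgr0Pnorm_le => e e0; near=> h.
  have h0 : h != 0 by near: h; exact: nbhs_dnbhs_neq.
  rewrite normrM normfV (ger0_norm (flat_ge0 n h)) ler_pdivrMl ?normr_gt0//.
  apply: (le_trans (flat_le_sqr n h)).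
  rewrite mulrA [leRHS]mulrC ler_wpM2r// -real_normK ?num_real//.
  have K0 : 0 < (n.+3)`!%:R :> R by rewrite ltr0n fact_gt0.
  rewrite mulrC -ler_pdivlMr//.
  (* What is left to bound is [|h|^2] by [e / (n+3)!]; with [|h| <= 1] it is at most [|h|]. *)
  have h1 : `|h| <= 1.
    near: h; apply: dnbhs0_le; exact: ltr01.
  have h2 : `|h| <= e / (n.+3)`!%:R.
    near: h; apply: dnbhs0_le; exact: divr_gt0.
  apply: le_trans h2; rewrite expr2 ler_piMl//.
Unshelve. all: by end_near. Qed.

Lemma smooth_flat n : smooth (flat n).
Proof.
have cflat m : continuous (flat m).
  move=> x; apply/differentiable_continuous/derivable1_diffP.
  by case: (is_derive_flat m x).
(* [is_Ck] asks for all directions, and a direction in R is a number [e], which only multiplies the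
   derivative. *)
have D m x e : is_derive x e (flat m) (e * (- m%:R * flat m.+1 x + flat m.+2 x)).
  have [d dE] := is_derive_flat m x.
  have df : differentiable (flat m) x by exact/derivable1_diffP.
  split; first exact: diff_derivable.
  by rewrite deriveE// -[X in 'd _ _ X]mulr1 linearZ/= -deriveE// dE.
move=> k; elim: k n => [|k IH] n; first exact: cflat.
split=> [|e]; first exact: cflat.
split=> [x|]; first by case: (D n x e).
have -> : 'D_e (flat n) =
    cst e \* ((cst (- n%:R) \* flat n.+1) \+ flat n.+2).
  by apply/funext => x; case: (D n x e) => _ ->.
apply: is_CkM; first exact: is_Ck_cst.
by apply: is_CkD => //; apply: is_CkM => //; exact: is_Ck_cst.
Qed.

(** With g the multiple of [flat 0] normalized by g(1) = 1, this is g(1 - g((x - a) / (b - a))). As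
    g is nondecreasing and vanishes on the negative half-line, the value is 1 up to [a] and 0 from
    [b] on. Composing g with itself, instead of dividing by a sum of two such functions, avoids the
    reciprocal of a function. *)
Definition step (a b x : R) : R :=
  (flat 0 1)^-1 * flat 0 (1 - (flat 0 1)^-1 * flat 0 ((x - a) / (b - a))).

Lemma flat1_gt0 : 0 < flat 0 1.
Proof. by rewrite /flat ltr01 expr0 mul1r expR_gt0. Qed.

Lemma flat_nd : {homo flat 0 : x y / x <= y}.
Proof.
move=> x y xy; rewrite {1}/flat; case: ifPn => [x0|_]; last exact: flat_ge0.
by rewrite /flat (lt_le_trans x0 xy) !expr0 !mul1r ler_expR lerN2 lef_pV2//
  posrE// (lt_le_trans x0).
Qed.

Lemma flat_le0 x : x <= 0 -> flat 0 x = 0.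
Proof. by move=> x0; rewrite /flat ltNge x0. Qed.

Lemma step_le a b x : a < b -> x <= a -> step a b x = 1.
Proof.
move=> ab xa; rewrite /step [flat 0 (_ / _)]flat_le0; last first.
  by rewrite mulr_le0_ge0 ?subr_le0// invr_ge0 subr_ge0 ltW.
by rewrite mulr0 subr0 mulVf// gt_eqF ?flat1_gt0.
Qed.

Lemma step_ge a b x : a < b -> b <= x -> step a b x = 0.
Proof.
move=> ab bx; rewrite /step [flat 0 (1 - _)]flat_le0 ?mulr0//.
rewrite subr_le0 ler_pdivlMl ?flat1_gt0// mulr1; apply: flat_nd.
by rewrite ler_pdivlMr ?subr_gt0// mul1r lerB.
Qed.

Lemma step_ge0 a b x : 0 <= step a b x.
Proof. by rewrite mulr_ge0 ?flat_ge0// invr_ge0 flat_ge0. Qed.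

Lemma step_le1 a b x : step a b x <= 1.
Proof.
rewrite /step ler_pdivrMl ?flat1_gt0// mulr1; apply: flat_nd.
by rewrite gerBl mulr_ge0 ?flat_ge0// invr_ge0 flat_ge0.
Qed.

Lemma smooth_step a b : smooth (step a b).
Proof.
have sid : smooth (id : R -> R).
  by move=> k; apply: (@is_Ck_linear _ _ k idfun) => x; exact: cvg_id.
apply: smoothM; first exact: smooth_cst.
apply: (@smooth_comp _ _ (flat 0)); first exact: smooth_flat.
have -> : (fun x => 1 - (flat 0 1)^-1 * flat 0 ((x - a) / (b - a))) =
   cst 1 \+ (cst (- (flat 0 1)^-1) \* (flat 0 \o ((id \+ cst (- a)) \* cst (b - a)^-1))).
  by apply/funext => x /=; rewrite mulNr.
apply: smoothD; first exact: smooth_cst.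
apply: smoothM; first exact: smooth_cst.
apply: smooth_comp; first exact: smooth_flat.
by apply: smoothM; [apply: smoothD => //|]; exact: smooth_cst.
Qed.

(** The constant [c] below [c / 2], the identity above [c], and a convex combination of [c] and [x]
    in between, where both are positive. *)
Definition posclip (c x : R) : R := c + (x - c) * (1 - step (c / 2) c x).

Lemma posclip_id c x : 0 < c -> c <= x -> posclip c x = x.
Proof. by move=> c0 cx; rewrite /posclip step_ge//; [ring|lra]. Qed.

Lemma posclip_gt0 c x : 0 < c -> 0 < posclip c x.
Proof.
move=> c0; have c2 : c / 2 < c by lra.
rewrite /posclip; have [xc|cx] := leP x (c / 2).
  by rewrite step_le// subrr mulr0 addr0.
have := step_ge0 (c / 2) c x; have := step_le1 (c / 2) c x.
set s := step _ _ _; move=> s1 s0.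
(* Written as a convex combination with weights [s] and [1 - s]; here [x > c / 2 > 0]. *)
have -> : c + (x - c) * (1 - s) = c * s + x * (1 - s) by ring.
nra.
Qed.

Lemma smooth_posclip c : smooth (posclip c).
Proof.
have sid : smooth (id : R -> R).
  by move=> k; apply: (@is_Ck_linear _ _ k idfun) => x; exact: cvg_id.
have -> : posclip c = cst c \+ ((id \+ cst (- c)) \*
    (cst 1 \+ (cst (-1) \* step (c / 2) c))).
  by apply/funext => x; rewrite /posclip /= mulN1r.
have sc (u : R) : smooth (cst u : R -> R) by exact: smooth_cst.
apply: smoothD; first exact: sc.
apply: smoothM; first by apply: smoothD; [exact: sid|exact: sc].
apply: smoothD; first exact: sc.
by apply: smoothM; [exact: sc|exact: smooth_step].
Qed.

End flat.

(** * Measurability and bounds of continuous functions on space-time *)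

Lemma continuous_pair (T U V : topologicalType) (f : T -> U) (g : T -> V) :
  continuous f -> continuous g -> continuous (fun x => (f x, g x)).
Proof. by move=> cf cg x; apply: cvg_pair; [exact: cf|exact: cg]. Qed.

Lemma continuous_compT (T U V : topologicalType) (f : T -> U) (g : U -> V) :
  continuous f -> continuous g -> continuous (g \o f).
Proof. by move=> cf cg x; apply: continuous_comp; [exact: cf|exact: cg]. Qed.

Section continuous_measurable.
Context {R : realType}.

Lemma floor_approx_cvg (x : R) :
  (Num.floor (x * n.+1%:R))%:~R / n.+1%:R @[n --> \oo] --> x.
Proof.
apply/cvgrPdist_le => e e0.
have := near_infty_natSinv_lt (PosNum e0); apply: filterS => n /= /ltW ne.
have n0 : (0 : R) < n.+1%:R by rewrite ltr0n.
apply: le_trans ne.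
have -> : x - (Num.floor (x * n.+1%:R))%:~R / n.+1%:R =
    (x * n.+1%:R - (Num.floor (x * n.+1%:R))%:~R) / n.+1%:R.
  by rewrite mulrBl mulfK// gt_eqF.
have /andP[f1 f2] := floor_itv (x * n.+1%:R).
rewrite normrM normfV (gtr0_norm n0) ler_pdivrMr// mulVf ?gt_eqF//.
rewrite ger0_norm ?subr_ge0// lerBlDl.
by move: f2; rewrite intrD => /ltW.
Qed.

(** Rounding the first variable down to a multiple of 1/(n+1) gives a function that on each of
    countably many strips depends on [y] alone, hence is measurable; by continuity in the first
    variable these functions converge pointwise to [f]. Used one coordinate at a time, this makes
    continuous functions measurable for the product sigma-algebra. *)
Lemma measurable_caratheodory d (Y : measurableType d) (f : R * Y -> R) :
  (forall y, continuous (fun x => f (x, y))) ->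
  (forall x, measurable_fun setT (fun y => f (x, y))) ->
  measurable_fun setT f.
Proof.
move=> cf mf.
pose h n (p : R * Y) := f ((Num.floor (p.1 * n.+1%:R))%:~R / n.+1%:R, p.2).
apply: (@measurable_fun_cvg _ _ _ _ h); last first.
  move=> [x y] _; rewrite /h /=.
  exact: (cvg_comp _ (fun x => f (x, y)) (@floor_approx_cvg x) (cf y x)).
move=> n _ B mB; rewrite setTI.
have n0 : (0 : R) < n.+1%:R by rewrite ltr0n.
have -> : h n @^-1` B = \bigcup_(k : int)
   ([set` `[k%:~R / n.+1%:R, (k + 1)%:~R / n.+1%:R[%R] `*`
    ((fun y => f (k%:~R / n.+1%:R, y)) @^-1` B)).
  apply/seteqP; split=> [[x y] /= hB|[x y] [k _ /= [xk kB]]].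
    exists (Num.floor (x * n.+1%:R)) => //; split => //=.
    by rewrite in_itv/= ler_pdivrMr// ltr_pdivlMr// floor_itv.
  suff fk : Num.floor (x * n.+1%:R) = k by rewrite /= /h /= fk.
  apply/floor_def; move: xk; rewrite in_itv/=.
  by rewrite ler_pdivrMr// ltr_pdivlMr.
apply: countable_bigcupT_measurable => // k.
apply: measurableX; first exact: measurable_itv.
by rewrite -[X in measurable X]setTI; exact: mf.
Qed.

Lemma measurable_swap_pair d1 d2 (T1 : measurableType d1) (T2 : measurableType d2) :
  measurable_fun setT (@swap_pair T1 T2).
Proof. by apply: measurable_fun_pair => //; exact: measurable_fst. Qed.

Lemma measurable_caratheodory2 d (Y : measurableType d) (f : Y * R -> R) :
  (forall y, continuous (fun x => f (y, x))) ->
  (forall x, measurable_fun setT (fun y => f (y, x))) ->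
  measurable_fun setT f.
Proof.
move=> cf mf; have -> : f = (f \o swap_pair) \o swap_pair by apply/funext => -[].
apply: measurableT_comp; last exact: measurable_swap_pair.
exact: measurable_caratheodory.
Qed.

Lemma continuous_measurable_space (f : space3 R -> R) :
  continuous f -> measurable_fun setT f.
Proof.
move=> cf.
have cid : continuous (id : R -> R) by move=> x; exact: cvg_id.
have cst (U : topologicalType) (u : U) : continuous (fun _ : R => u).
  by move=> x; exact: cvg_cst.
apply: measurable_caratheodory2 => [xy|z].
  exact: (continuous_compT (continuous_pair (cst _ xy) cid) cf).
apply: measurable_caratheodory => [y|x].
  exact: (continuous_compT
    (continuous_pair (continuous_pair cid (cst _ y)) (cst _ z)) cf).
apply: continuous_measurable_fun.
exact: (continuous_compT
  (continuous_pair (continuous_pair (cst _ x) cid) (cst _ z)) cf).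
Qed.

Lemma continuous_slice (f : spacetime R -> R) t :
  continuous f -> continuous (slice f t).
Proof.
move=> cf; apply: (@continuous_compT _ _ _ (pair t) f) => //.
by apply: (@continuous_pair _ _ _ (fun=> t) id) => x; [exact: cvg_cst|exact: cvg_id].
Qed.

Lemma continuous_line (f : spacetime R -> R) q :
  continuous f -> continuous (fun t => f (t, q)).
Proof.
move=> cf; apply: (@continuous_compT _ _ _ (pair^~ q) f) => //.
by apply: (@continuous_pair _ _ _ id (fun=> q)) => x; [exact: cvg_id|exact: cvg_cst].
Qed.

Lemma continuous_measurable_spacetime (f : spacetime R -> R) :
  continuous f -> measurable_fun setT f.
Proof.
move=> cf; apply: measurable_caratheodory => [q|t]; first exact: continuous_line.
by apply: continuous_measurable_space; exact: continuous_slice.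
Qed.

(** [Omega] is not closed, so bounds and minima are taken on this compact set containing it. *)
Definition closed_cell : set (space3 R) := (`[0, 1] `*` `[0, 1]) `*` `[-1, 1].

Lemma sub_closed_cell : @Omega R `<=` closed_cell.
Proof.
move=> [[x y] z] [[/= x1 y1] z1]; split; first split => /=.
- exact: subset_itv_co_cc x1.
- exact: subset_itv_co_cc y1.
- exact: subset_itv_oo_cc z1.
Qed.

Lemma compact_cylinder (T : R) : compact (`[0, T] `*` closed_cell).
Proof. by do 3 (try apply: compact_setX); exact: segment_compact. Qed.

Lemma bounded_cylinder (T : R) (f : spacetime R -> R) : continuous f ->
  exists M : R, forall t q, t \in `[0, T] -> Omega q -> `|f (t, q)| <= M.
Proof.
move=> cf.
have cA : compact (f @` (`[0, T] `*` closed_cell)).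
  apply: continuous_compact; last exact: compact_cylinder.
  exact: continuous_subspaceT.
have [M [Mr bM]] := compact_bounded cA.
exists (M + 1) => t q tT Oq; apply: (bM (M + 1)); first by rewrite ltrDl.
by exists (t, q) => //; split=> //=; exact: sub_closed_cell.
Qed.

Lemma positive_cylinder (T : R) (f : spacetime R -> R) : 0 <= T -> continuous f ->
  (forall t q, t \in `[0, T] -> 0 < f (t, q)) ->
  exists2 c : R, 0 < c & forall t q, t \in `[0, T] -> Omega q -> c < f (t, q).
Proof.
move=> T0 cf f0.
have ne : (`[0, T] `*` closed_cell) !=set0.
  exists (0, (0, 0, 0)); split => /=; first by rewrite in_itv/= lexx.
  by split; [split|]; rewrite /= in_itv/= ?lexx ?lerN10 ?ler01.
have [[t0 q0] /set_mem[/= t0T _] H] := compact_EVT_min ne (@compact_cylinder T)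
  (continuous_subspaceT cf).
(* Half the minimum, to have a strict inequality: it then persists on a neighbourhood of each point,
   which is needed to compare derivatives. *)
exists (f (t0, q0) / 2); first by rewrite divr_gt0// f0.
move=> t q tT Oq; apply: (@lt_le_trans _ _ (f (t0, q0))).
  by rewrite ltr_pdivrMr// ltr_pMr ?f0// ltr1n.
by apply: H; apply/mem_set; split => //=; exact: sub_closed_cell.
Qed.

End continuous_measurable.

(** * Integrable functions and the space L^2 with weight [rho] *)

Section weighted.
Context d (X : measurableType d) (R : realType) (mu : {measure set X -> \bar R}).
Context (D : set X) (mD : measurable D).
Implicit Types f g b : X -> R.
Local Notation rint f := (mu.-integrable D (EFin \o f)).

Lemma rint_measurable f : rint f -> measurable_fun D f.
Proof. by case/integrableP => /measurable_EFinP. Qed.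

Lemma rint_le f g : measurable_fun D f ->
  (forall x, D x -> `|f x| <= g x) -> rint g -> rint f.
Proof.
move=> mf fg; apply: le_integrable => //; first exact/measurable_EFinP.
by move=> x Dx /=; rewrite lee_fin (le_trans (fg _ Dx))// ler_norm.
Qed.

Lemma eq_rint f g : (forall x, D x -> f x = g x) -> rint f -> rint g.
Proof.
by move=> fg; apply: eq_integrable => // x /set_mem /fg /= ->.
Qed.

Lemma rintD f g : rint f -> rint g -> rint (fun x => f x + g x).
Proof.
move=> f1 g1; have -> : EFin \o (fun x => f x + g x) = ((EFin \o f) \+ (EFin \o g))%E.
  by apply/funext => x /=; rewrite EFinD.
exact: integrableD.
Qed.

Lemma rintZ (c : R) f : rint f -> rint (fun x => c * f x).
Proof.
by move=> f1; have := integrableZl mD c f1; apply: eq_integrable => // x _ /=.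
Qed.

Lemma rintN f : rint f -> rint (fun x => - f x).
Proof. by move=> /(rintZ (-1)); apply: eq_rint => x _; rewrite mulN1r. Qed.

Lemma rintB f g : rint f -> rint g -> rint (fun x => f x - g x).
Proof. by move=> f1 g1; apply: rintD => //; exact: rintN. Qed.

Lemma rint_sum n (F : 'I_n -> X -> R) :
  (forall i, rint (F i)) -> rint (fun x => \sum_(i < n) F i x).
Proof.
elim: n F => [|n IH] F iF.
  under eq_fun do rewrite big_ord0.
  by apply: (@eq_rint (cst 0)) => //; exact: integrable0.
under eq_fun do rewrite big_ord_recr/=.
by apply: rintD => //; exact: IH.
Qed.

Lemma rintM f b (M : R) : rint f -> measurable_fun D b ->
  (forall x, D x -> `|b x| <= M) -> rint (fun x => f x * b x).
Proof.
move=> f1 mb bM.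
apply: (@rint_le _ (fun x => M * `|f x|)).
- by apply: measurable_funM => //; exact: rint_measurable.
- by move=> x Dx; rewrite normrM mulrC ler_wpM2r// bM.
- by apply: rintZ; exact: integrable_norm.
Qed.

Lemma rint_cst (c : R) : (mu D < +oo)%E -> rint (fun=> c).
Proof.
by move=> ?; apply: measurable_bounded_integrable => //; exact: bounded_cst.
Qed.

Variables (rho : X -> R) (mrho : measurable_fun D rho).
Hypothesis rho_ge0 : forall x, D x -> 0 <= rho x.

(* L^2(rho mu) on D *)
Definition wL2 f := measurable_fun D f /\ rint (fun x => rho x * f x ^+ 2).

Lemma wL2D f g : wL2 f -> wL2 g -> wL2 (fun x => f x + g x).
Proof.
move=> [mf f2] [mg g2]; split; first exact: measurable_funD.
apply: (@rint_le _ (fun x => 2 * (rho x * f x ^+ 2 + rho x * g x ^+ 2))).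
- apply: measurable_funM => //; apply: measurable_funX; exact: measurable_funD.
- move=> x Dx; rewrite (ger0_norm (mulr_ge0 (rho_ge0 Dx) (sqr_ge0 _))).
  rewrite -mulrDr [leRHS]mulrCA ler_wpM2l ?rho_ge0//.
  (* This is [(f + g)^2 <= 2 (f^2 + g^2)]. *)
  by have := sqr_ge0 (f x - g x); nra.
- by apply: rintZ; exact: rintD.
Qed.

Lemma wL2M f b (M : R) : wL2 f -> measurable_fun D b ->
  (forall x, D x -> `|b x| <= M) -> wL2 (fun x => f x * b x).
Proof.
move=> [mf f2] mb bM; split; first exact: measurable_funM.
apply: (@eq_rint (fun x => rho x * f x ^+ 2 * b x ^+ 2)).
  by move=> x _; rewrite exprMn; ring.
apply: (@rintM _ _ (M ^+ 2)) => //; first exact: measurable_funX.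
by move=> x Dx; rewrite normrX ler_sqr ?nnegrE// ?bM// (le_trans _ (bM _ Dx)).
Qed.

Lemma wL2_bounded b (M : R) : rint rho -> measurable_fun D b ->
  (forall x, D x -> `|b x| <= M) -> wL2 b.
Proof.
move=> r1 mb bM; split => //.
apply: (@rintM _ _ (M ^+ 2)) => //; first exact: measurable_funX.
by move=> x Dx; rewrite normrX ler_sqr ?nnegrE// ?bM// (le_trans _ (bM _ Dx)).
Qed.

Lemma wL2N f : wL2 f -> wL2 (fun x => - f x).
Proof.
move=> [mf f2]; split; first exact: measurableT_comp.
by apply: eq_rint f2 => x _; rewrite sqrrN.
Qed.

Lemma wL2_sum n (F : 'I_n -> X -> R) : 
  (forall i, wL2 (F i)) -> wL2 (fun x => \sum_(i < n) F i x).
Proof.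
elim: n F => [|n IH] F iF.
  under eq_fun do rewrite big_ord0; split; first exact: measurable_cst.
  apply: (@eq_rint (cst 0)) => [x _|]; first by rewrite expr0n mulr0.
  exact: integrable0.
under eq_fun do rewrite big_ord_recr/=.
by apply: wL2D => //; exact: IH.
Qed.

(** The pointwise bound [|f g| <= f^2 + g^2] suffices, since only integrability is wanted and no
    norm estimate. *)
Lemma wL2_mul f g : wL2 f -> wL2 g -> rint (fun x => rho x * (f x * g x)).
Proof.
move=> [mf f2] [mg g2].
apply: (@rint_le _ (fun x => rho x * f x ^+ 2 + rho x * g x ^+ 2)).
- by apply: measurable_funM => //; exact: measurable_funM.
- move=> x Dx; rewrite normrM ger0_norm ?rho_ge0// -mulrDr ler_wpM2l ?rho_ge0//.
  by rewrite ler_norml; have := sqr_ge0 (f x - g x); have := sqr_ge0 (f x + g x); nra.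
- exact: rintD.
Qed.

End weighted.

(** * Tonelli and Fubini on a product of two sets *)

Section rectangles.
Context d1 d2 (T1 : measurableType d1) (T2 : measurableType d2) (R : realType).
Variables (m1 : {sigma_finite_measure set T1 -> \bar R})
  (m2 : {sigma_finite_measure set T2 -> \bar R}).
Variables (A : set T1) (B : set T2).
Hypotheses (mA : measurable A) (mB : measurable B).
Variable f : T1 * T2 -> R.

(** Extension by zero turns integrals over the rectangle into integrals over the whole product
    space; the four facts below describe its sections. *)
Let fr := (EFin \o f) \_ (A `*` B).

Let fr1 x y : A x -> fr (x, y) = ((fun y => (f (x, y))%:E) \_ B) y.
Proof.
move=> Ax; rewrite /fr !patchE; congr (if _ then _ else _).
by rewrite in_setX (mem_set Ax).
Qed.

Let fr1N x y : ~ A x -> fr (x, y) = 0%E.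
Proof. by move=> Ax; rewrite /fr patchE in_setX (memNset Ax). Qed.

Let fr2 x y : B y -> fr (x, y) = ((fun x => (f (x, y))%:E) \_ A) x.
Proof.
move=> By; rewrite /fr !patchE; congr (if _ then _ else _).
by rewrite in_setX (mem_set By) andbT.
Qed.

Let fr2N x y : ~ B y -> fr (x, y) = 0%E.
Proof. by move=> By; rewrite /fr patchE in_setX (memNset By) andbF. Qed.

Lemma measurable_slice x : measurable_fun (A `*` B) f -> A x ->
  measurable_fun B (fun y => f (x, y)).
Proof.
move=> /(measurable_restrictT _ (measurableX mA mB)).1 mf Ax.
apply/(measurable_restrictT _ mB).
have -> : (fun y => f (x, y)) \_ B = (f \_ (A `*` B)) \o (pair x).
  by apply/funext => y /=; rewrite !patchE in_setX (mem_set Ax).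
by apply: measurableT_comp.
Qed.

Lemma tonelli_bounded (C : R) : measurable_fun (A `*` B) f ->
  (forall p, (A `*` B) p -> 0 <= f p) -> (m1 A < +oo)%E ->
  {ae m1, forall x, A x -> (\int[m2]_(y in B) (f (x, y))%:E <= C%:E)%E} ->
  (m1 \x m2)%E.-integrable (A `*` B) (EFin \o f).
Proof.
move=> mf f0 Afin bnd.
have mr : measurable_fun setT fr.
  apply: (measurable_restrictT _ (measurableX mA mB)).1.
  exact/measurable_EFinP.
have r0 p : (0 <= fr p)%E.
  by rewrite /fr patchE; case: ifPn => // /set_mem /f0; rewrite lee_fin.
apply/integrable_mkcond; first exact: measurableX.
apply/integrableP; split=> //.
under eq_integral do rewrite gee0_abs//.
rewrite fubini_tonelli1//.
have mF : measurable_fun setT (fubini_F m2 fr).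
  exact: measurable_fun_fubini_tonelli_F.
(* The dominating constant has to be nonnegative, and [C] need not be: it bounds slices only for
   almost every [x] in [A], which may be null. *)
apply: (@le_lt_trans _ _ (\int[m1]_(x in A) (cst (Num.max C 0)%:E x))%E); last first.
  rewrite integral_cst//; apply: lte_mul_pinfty => //.
  by rewrite lee_fin le_max lexx orbT.
rewrite [leRHS]integral_mkcond; apply: ae_ge0_le_integral => //.
- by move=> x _; exact: integral_ge0.
- by move=> x _; rewrite patchE; case: ifPn => //= _; rewrite lee_fin le_max lexx orbT.
- by apply/(measurable_restrictT _ mA).1; exact: measurable_cst.
apply: filterS bnd => x Hx _; rewrite patchE /fubini_F; case: ifPn => [/set_mem Ax|Ax].
  rewrite [leLHS](_ : _ = \int[m2]_(y in B) (f (x, y))%:E)%E.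
    by apply: (le_trans (Hx Ax)); rewrite lee_fin le_max lexx.
  by rewrite [RHS]integral_mkcond; apply: eq_integral => y _; exact: fr1.
rewrite integral0_eq// => y _; apply: fr1N => Ax'.
by rewrite (mem_set Ax') in Ax.
Qed.

Hypothesis intf : (m1 \x m2)%E.-integrable (A `*` B) (EFin \o f).

Let intfr : (m1 \x m2)%E.-integrable setT fr.
Proof. by apply/(integrable_mkcond _ (measurableX mA mB)). Qed.

Lemma fubini_rectangle12 :
  (\int[m1 \x m2]_(p in A `*` B) (f p)%:E =
   \int[m1]_(x in A) \int[m2]_(y in B) (f (x, y))%:E)%E.
Proof.
rewrite integral_mkcond -[LHS](integral12_prod_meas1 intfr) [RHS]integral_mkcond.
apply: eq_integral => x _; rewrite patchE /fubini_F; case: ifPn => [/set_mem Ax|Ax].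
  by under eq_integral do rewrite fr1//; rewrite -integral_mkcond.
rewrite integral0_eq// => y _; apply: fr1N => Ax'.
by rewrite (mem_set Ax') in Ax.
Qed.

Lemma fubini_rectangle21 :
  (\int[m1 \x m2]_(p in A `*` B) (f p)%:E =
   \int[m2]_(y in B) \int[m1]_(x in A) (f (x, y))%:E)%E.
Proof.
rewrite integral_mkcond -[LHS](integral21_prod_meas1 intfr) [RHS]integral_mkcond.
apply: eq_integral => y _; rewrite patchE /fubini_G; case: ifPn => [/set_mem By|By].
  by under eq_integral do rewrite fr2//; rewrite -integral_mkcond.
rewrite integral0_eq// => x _; apply: fr2N => By'.
by rewrite (mem_set By') in By.
Qed.

Lemma fubini_rectangle_ae0 :
  {ae m1, forall x, A x -> (\int[m2]_(y in B) (f (x, y))%:E = 0)%E} ->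
  (\int[m1 \x m2]_(p in A `*` B) (f p)%:E = 0)%E.
Proof.
move=> H; rewrite integral_mkcond -[LHS](integral12_prod_meas1 intfr).
rewrite (@ae_eq_integral _ _ _ _ _ (cst 0%E))//.
- by rewrite integral0.
- exact: measurable_fubini_F intfr.
apply: filterS H => x H _; rewrite /fubini_F; have [Ax|Ax] := pselect (A x).
  rewrite -(H Ax) [RHS]integral_mkcond.
  by apply: eq_integral => y _; exact: fr1.
by rewrite integral0_eq// => y _; exact: fr1N.
Qed.

Lemma ae_integrable_rectangle :
  {ae m1, forall x, A x -> m2.-integrable B (fun y => (f (x, y))%:E)}.
Proof.
have := ae_integrable1 intfr; apply: filterS => x H Ax.
apply/integrable_mkcond => //.
by apply: eq_integrable H => // y _; rewrite fr1.
Qed.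

End rectangles.

(** * The periodic cell and the space-time cylinder *)

Section domains.
Context {R : realType}.

Lemma measurable_Omega : measurable (@Omega R).
Proof. by apply: measurableX; [apply: measurableX|]; exact: measurable_itv. Qed.

Lemma measurable_cylinder (i : interval R) : measurable (cylinder [set` i]).
Proof. by apply: measurableX; [exact: measurable_itv|exact: measurable_Omega]. Qed.

Lemma mu_Omega_fin : (@mu_space R (@Omega R) < +oo)%E.
Proof.
rewrite [X in (X < _)%E]product_measure1E; last 2 first.
- by apply: measurableX; exact: measurable_itv.
- exact: measurable_itv.
apply: lte_mul_pinfty; first exact: measure_ge0.
  rewrite [X in X \is a fin_num]product_measure1E; [|exact: measurable_itv..].
  have E1 : @lebesgue_measure R `[0, 1[ = 1%E.
    by rewrite lebesgue_measure_itv/= lte_fin ltr01 sube0.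
  by rewrite [X in (X * X)%E]E1 mule1.
by rewrite [X in (X < _)%E]lebesgue_measure_itv/=; case: ifP => _; rewrite -?EFinB ltry.
Qed.

Lemma mu_cylinder_fin (a b : R) :
  (@mu_spacetime R (cylinder `]a, b[) < +oo)%E.
Proof.
rewrite [X in (X < _)%E]product_measure1E; last 2 first.
- exact: measurable_itv.
- exact: measurable_Omega.
apply: lte_mul_pinfty; first exact: measure_ge0.
  by rewrite [X in X \is a fin_num]lebesgue_measure_itv/=; case: ifP => _; rewrite -?EFinB.
exact: mu_Omega_fin.
Qed.

Lemma fubini_cylinder_ae0 (a b : R) (f : spacetime R -> R) :
  (@mu_spacetime R).-integrable (cylinder `]a, b[) (EFin \o f) ->
  {ae @lebesgue_measure R, forall t, t \in `]a, b[ ->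
    (\int[@mu_space R]_(q in @Omega R) (f (t, q))%:E = 0)%E} ->
  (\int[@mu_spacetime R]_(a in cylinder `]a, b[) (f a)%:E = 0)%E.
Proof.
exact: (@fubini_rectangle_ae0 _ _ _ _ R (@lebesgue_measure R) (@mu_space R)
  `]a, b[ (@Omega R) (measurable_itv _) measurable_Omega f).
Qed.

Lemma fubini_cylinder21 (i : interval R) (f : spacetime R -> R) :
  (@mu_spacetime R).-integrable (cylinder [set` i]) (EFin \o f) ->
  (\int[@mu_spacetime R]_(a in cylinder [set` i]) (f a)%:E =
   \int[@mu_space R]_(q in @Omega R)
     \int[@lebesgue_measure R]_(t in [set` i]) (f (t, q))%:E)%E.
Proof.
exact: (@fubini_rectangle21 _ _ _ _ R (@lebesgue_measure R) (@mu_space R)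
  [set` i] (@Omega R) (measurable_itv i) measurable_Omega f).
Qed.

Lemma ae_integrable_cylinder (i : interval R) (f : spacetime R -> R) :
  (@mu_spacetime R).-integrable (cylinder [set` i]) (EFin \o f) ->
  {ae @lebesgue_measure R, forall t, [set` i] t ->
    (@mu_space R).-integrable (@Omega R) (fun q => (f (t, q))%:E)}.
Proof.
exact: (@ae_integrable_rectangle _ _ _ _ R (@lebesgue_measure R) (@mu_space R)
  [set` i] (@Omega R) (measurable_itv i) measurable_Omega f).
Qed.

Lemma fubini_Omega12 (f : space3 R -> R) :
  (@mu_space R).-integrable (@Omega R) (EFin \o f) ->
  (\int[@mu_space R]_(q in @Omega R) (f q)%:E =
   \int[@mu_plane R]_(xy in `[0%R, 1%R[ `*` `[0%R, 1%R[)
     \int[@lebesgue_measure R]_(z in `](-1)%R, 1%R[) (f (xy, z))%:E)%E.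
Proof.
have mO : measurable (`[(0 : R), 1[ `*` `[(0 : R), 1[).
  by apply: measurableX; exact: measurable_itv.
exact: (@fubini_rectangle12 _ _ _ _ R (@mu_plane R) (@lebesgue_measure R)
  _ _ mO (measurable_itv `](-1), 1[) f).
Qed.

Lemma integrable_cylinder_bounded (a b C : R) (f : spacetime R -> R) :
  measurable_fun (cylinder `]a, b[) f ->
  (forall p, cylinder `]a, b[ p -> 0 <= f p) ->
  {ae @lebesgue_measure R, forall t, t \in `]a, b[ ->
    (\int[@mu_space R]_(q in @Omega R) (f (t, q))%:E <= C%:E)%E} ->
  (@mu_spacetime R).-integrable (cylinder `]a, b[) (EFin \o f).
Proof.
move=> mf f0.
apply: (@tonelli_bounded _ _ _ _ R (@lebesgue_measure R) (@mu_space R)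
  `]a, b[ (@Omega R) (measurable_itv _) measurable_Omega f C mf f0).
rewrite [X in (X < _)%E]lebesgue_measure_itv/=.
by case: ifP => _; rewrite -?EFinB ltry.
Qed.

Lemma measurable_slice_cylinder (i : interval R) (f : spacetime R -> R) t :
  measurable_fun (cylinder [set` i]) f -> t \in i ->
  measurable_fun (@Omega R) (slice f t).
Proof.
exact: (@measurable_slice _ _ (measurableTypeR R) _ R [set` i] (@Omega R)
  (measurable_itv i) measurable_Omega f).
Qed.

End domains.

(** * The fundamental theorem of calculus along coordinate lines *)

Section sections.
Context {R : realType} {E : normedModType R}.

(** The condition on [l] says that it is an affine line with direction [e]; time lines and vertical
    lines are the instances used. *)
Lemma is_derive_section (f : E -> R) (l : R -> E) (e : E) (t : R) :
  (forall h, l (h + t) = h *: e + l t) -> derivable f (l t) e ->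
  is_derive t 1 (f \o l) ('D_e f (l t)).
Proof.
move=> lh df.
have K : (fun h : R => h^-1 *: ((f \o l) (h *: 1 + t) - (f \o l) t)) =
         (fun h : R => h^-1 *: (f (h *: e + l t) - f (l t))).
  by apply/funext => h /=; rewrite -lh [h *: 1]mulr1.
by split; rewrite /derivable /derive /= K.
Qed.

(** Open intervals are those of [int_cyl] and of the vertical range of [Omega]; the endpoints carry
    no mass. *)
Lemma FTC_open (g g' : R -> R) (a b : R) : a < b ->
  (forall x : R, is_derive x 1 g (g' x)) -> continuous g' ->
  (\int[@lebesgue_measure R]_(x in `]a, b[) (g' x)%:E = (g b - g a)%:E)%E.
Proof.
move=> ab dg cg'.
have cg : continuous g.
  by move=> x; apply/differentiable_continuous/derivable1_diffP; case: (dg x).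
rewrite -(integral_itv_bndoo true false); last first.
  apply/measurable_EFinP; apply: measurable_funS (continuous_measurable_fun cg') => //.
rewrite (@continuous_FTC2 _ g' g) ?EFinB//.
- exact: continuous_subspaceT.
- split => [x _||]; first by case: (dg x).
  + exact/cvg_at_right_filter/cg.
  + exact/cvg_at_left_filter/cg.
- by move=> x _; rewrite derive1E; case: (dg x).
Qed.

End sections.

Section FTC_cylinder.
Context {R : realType}.
Implicit Types (f g : spacetime R -> R).

Lemma dt_section f (t : R) q : smooth f ->
  is_derive t 1 (fun s => f (s, q)) (dt f (t, q)).
Proof.
move=> sf; apply: (@is_derive_section _ _ f (pair^~ q) (1, 0)).
  move=> h; congr (_, _) => /=; first by rewrite [_ *: _]mulr1.
  by rewrite scaler0 add0r.
exact: smooth_derivable.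
Qed.

Lemma dz_section f (t : R) xy (z : R) : smooth f ->
  is_derive z 1 (fun s => f (t, (xy, s))) (dz f (t, (xy, z))).
Proof.
move=> sf; apply: (@is_derive_section _ _ f (fun s => (t, (xy, s))) (0, dir R vertical)).
  move=> h; congr (_, (_, _)) => /=.
  - by rewrite [_ *: 0]mulr0 add0r.
  - case: xy => x y; congr (_, _); rewrite /= /GRing.scale/= mulr0 add0r//.
  - by rewrite [_ *: _]mulr1.
exact: smooth_derivable.
Qed.

Lemma dz_z_independent f a : z_independent f -> dz f a = 0.
Proof.
move=> fz; rewrite /dz /ds derive_line.
have -> : (fun h : R => f (h *: (0, dir R vertical) + a)) = cst (f a).
  apply/funext => h; case: a => t [[x y] z] /=.
  have -> : h *: (0, dir R vertical) + (t, ((x, y), z)) = (t, ((x, y), h + z)).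
    congr (_, ((_, _), _)) => /=; rewrite /GRing.scale/= ?mulr0 ?add0r//.
    by rewrite mulr1.
  exact: fz.
by rewrite derive_cst.
Qed.

Lemma rint_continuous_cylinder (tau : R) f : continuous f ->
  (@mu_spacetime R).-integrable (cylinder `]0, tau[) (EFin \o f).
Proof.
move=> cf; have [M bM] := bounded_cylinder tau cf.
apply: measurable_bounded_integrable.
- exact: measurable_cylinder.
- exact: mu_cylinder_fin.
- by apply: measurable_funTS; exact: continuous_measurable_spacetime.
exists M; split; first exact: num_real.
move=> M' MM' [t q] [/= tT Oq]; apply: le_trans (ltW MM'); apply: bM => //.
exact: subset_itv_oo_cc tT.
Qed.

Lemma rint_continuous_Omega (tau t : R) f : continuous f -> t \in `[0, tau] ->
  (@mu_space R).-integrable (@Omega R) (EFin \o slice f t).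
Proof.
move=> cf tT; have [M bM] := bounded_cylinder tau cf.
apply: measurable_bounded_integrable.
- exact: measurable_Omega.
- exact: mu_Omega_fin.
- apply: measurable_funTS; apply: continuous_measurable_space.
  exact: continuous_slice.
exists M; split; first exact: num_real.
by move=> M' MM' q Oq; apply: le_trans (ltW MM'); apply: bM.
Qed.

(** Fubini with the time integral innermost reduces this to the fundamental theorem at each point of
    the cell. *)
Lemma bracket_smooth (tau : R) f : 0 < tau -> smooth f ->
  bracket f tau = int_cyl (dt f) tau.
Proof.
move=> tau0 sf.
have cf := smooth_continuous sf.
have cdf : continuous (dt f) by exact/smooth_continuous/smooth_derive.
rewrite /bracket /int_Omega /int_cyl -RintegralB; last 3 first.
- exact: measurable_Omega.
- by apply: (@rint_continuous_Omega tau) => //; rewrite in_itv/= lexx ltW.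
- by apply: (@rint_continuous_Omega tau) => //; rewrite in_itv/= lexx ltW.
congr fine.
rewrite [RHS](fubini_cylinder21 (rint_continuous_cylinder tau cdf)).
have inner (q : space3 R) : (\int[@lebesgue_measure R]_(t in `]0%R, tau[)
    (dt f (t, q))%:E = (f (tau, q) - f (0, q))%:E)%E.
  exact: (FTC_open tau0 (fun t => dt_section t q sf) (continuous_line (q := q) cdf)).
by apply: eq_integral => q _; rewrite inner.
Qed.

(** On a vertical line [g] is a constant factor, and the integral of [dz f] is the difference of two
    values of [f] one period apart. No regularity of [g] enters, so [g] can be the pressure of a
    weak solution. *)
Lemma int_cyl_dz_eq0 (tau : R) f g : z_independent g -> smooth_periodic f ->
  (@mu_spacetime R).-integrable (cylinder `]0, tau[) (fun a => (g a * dz f a)%:E) ->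
  int_cyl (fun a => g a * dz f a) tau = 0.
Proof.
move=> gz [sf pf] fi.
have cdf : continuous (dz f) by exact/smooth_continuous/smooth_derive.
have ae0 : {ae @lebesgue_measure R, forall t, t \in `]0, tau[ ->
    (\int[@mu_space R]_(q in @Omega R) (g (t, q) * dz f (t, q))%:E = 0)%E}.
  have := ae_integrable_cylinder fi.
  apply: (@filterS _ _ (ae_filter_ringOfSetsType _)) => t H tI.
  rewrite (fubini_Omega12 (H tI)).
  have inner (xy : R * R) : (\int[@lebesgue_measure R]_(z in `](-1)%R, 1%R[)
      (g (t, (xy, z)) * dz f (t, (xy, z)))%:E = 0)%E.
    case: xy => x y.
    transitivity (\int[@lebesgue_measure R]_(z in `](-1)%R, 1%R[)
        (g (t, (x, y, 0)) * dz f (t, (x, y, z)))%:E)%E.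
      by apply: eq_integral => z _; rewrite (gz _ _ _ z 0).
    have dl (z : R) : is_derive z 1 (fun z => g (t, (x, y, 0)) * f (t, (x, y, z)))
        (g (t, (x, y, 0)) * dz f (t, (x, y, z))).
      exact: (is_deriveZ (g (t, (x, y, 0))) (dz_section t (x, y) z sf)).
    have cl : continuous (fun z => g (t, (x, y, 0)) * dz f (t, (x, y, z))).
      move=> z; apply: cvgM; first exact: cvg_cst.
      have cs : continuous (fun s : R => (t, ((x, y), s))).
        have cc (U : topologicalType) (u : U) : continuous (fun _ : R => u).
          by move=> s; exact: cvg_cst.
        apply: (continuous_pair (cc _ t)); apply: (continuous_pair (cc _ (x, y))).
        by move=> s; exact: cvg_id.
      exact: (continuous_compT cs cdf).
    have n11 : -1 < 1 :> R by lra.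
    rewrite (FTC_open n11 dl cl); have [_ _] := pf t x y (-1); rewrite /slice.
    (* The vertical period 2 takes the lower end of the cell to the upper one. *)
    have -> : -1 + 2 = 1 :> R by lra.
    by move=> ->; rewrite subrr.
  by rewrite integral0_eq// => xy _; exact: inner.
by have := fubini_cylinder_ae0 fi ae0; rewrite /int_cyl /Rintegral => ->.
Qed.

End FTC_cylinder.

(** * The pressure potential in closed form *)

Section potential.
Context {R : realType}.
Variable gamma : R.
Hypothesis gamma_gt1 : 1 < gamma.

Let g1 : gamma - 1 != 0. Proof. by rewrite gt_eqF// subr_gt0. Qed.

Lemma pressure_over_sqr (y : R) : 0 < y ->
  pressure gamma y / y ^+ 2 = y `^ (gamma - 2).
Proof.
move=> y0; rewrite /pressure powRB; last by apply/implyP => _; rewrite gt_eqF.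
by rewrite (@powR_mulrn _ y 2) ?ltW.
Qed.

Lemma int_pressure_over_sqr (a b : R) : 0 < a -> a <= b ->
  (\int[@lebesgue_measure R]_(y in `[a, b]) (pressure gamma y / y ^+ 2))%R =
  (b `^ (gamma - 1) - a `^ (gamma - 1)) / (gamma - 1).
Proof.
move=> a0; rewrite le_eqVlt => /predU1P[<-|ab].
  by rewrite set_itv1 Rintegral_set1 subrr mul0r.
have E : {in `[a, b]%classic, (fun y => pressure gamma y / y ^+ 2) =1
    (fun y => y `^ (gamma - 2))}.
  move=> y; rewrite inE/= in_itv/= => /andP[ay _].
  by rewrite pressure_over_sqr// (lt_le_trans a0).
transitivity (\int[@lebesgue_measure R]_(y in `[a, b]) (y `^ (gamma - 2)))%R.
  exact: eq_Rintegral.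
rewrite /Rintegral.
have dF (x : R) : 0 < x -> is_derive x 1 (fun y => (gamma - 1)^-1 * y `^ (gamma - 1))
    (x `^ (gamma - 2)).
  move=> x0; have := is_deriveZ (gamma - 1)^-1 (is_derive1_powR (gamma - 1) x0).
  by rewrite /GRing.scale/= mulrA mulVf// mul1r -addrA -opprD.
have cpow (c x : R) : 0 < x -> {for x, continuous (fun y : R => y `^ c)}.
  move=> x0; apply/differentiable_continuous/derivable1_diffP.
  by have [] := is_derive1_powR c x0.
rewrite (@continuous_FTC2 _ _ (fun y => (gamma - 1)^-1 * y `^ (gamma - 1)))//.
- by rewrite -EFinB/= -mulrBr mulrC.
- apply: continuous_in_subspaceT => y; rewrite inE/= in_itv/= => /andP[ay _].
  by apply: cpow; exact: lt_le_trans ay.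
- have cF (x : R) : 0 < x ->
      {for x, continuous (fun y => (gamma - 1)^-1 * y `^ (gamma - 1))}.
    move=> x0; apply/differentiable_continuous/derivable1_diffP.
    by have [] := dF x x0.
  split => [x /[!in_itv]/= /andP[ax _]||].
  + by have [] := dF x (lt_trans a0 ax).
  + exact/cvg_at_right_filter/cF.
  + by apply/cvg_at_left_filter/cF; exact: lt_trans ab.
- move=> x /[!in_itv]/= /andP[ax _]; rewrite derive1E.
  by have [] := dF x (lt_trans a0 ax).
Qed.

(** The integrand defining the potential is [y^(gamma - 2)], with primitive
    [y^(gamma - 1) / (gamma - 1)]. The value at 0 comes from the factor [s] in front of the
    integral; it is included because the density may vanish. *)
Lemma potentialE (s : R) : 0 <= s ->
  potential gamma s = (s `^ gamma - s) / (gamma - 1).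
Proof.
rewrite le_eqVlt => /predU1P[<-|s0].
  rewrite /potential mul0r powR0 ?subrr ?mul0r// gt_eqF//.
  exact: lt_trans gamma_gt1.
have sg : s * s `^ (gamma - 1) = s `^ gamma.
  by rewrite mulr_powRB1 ?ltW// (lt_trans _ gamma_gt1).
(* For [s] below 1 the integral runs from [s] to 1 with a minus sign, and the same formula
   results. *)
rewrite /potential /oriented_int; case: ifPn => [s1|]; last rewrite -ltNge => /ltW s1.
  by rewrite int_pressure_over_sqr// powR1 mulrA mulrBr mulr1 sg.
by rewrite int_pressure_over_sqr// powR1 -mulNr opprB mulrA mulrBr mulr1 sg.
Qed.

(** The closed form is available for nonnegative arguments, so derivatives at a positive point are
    computed through equality on a neighbourhood. *)
Lemma near_potential (s : R) : 0 < s ->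
  \forall y \near s, (gamma - 1)^-1 * (y `^ gamma - y) = potential gamma y.
Proof.
move=> s0; near=> y; rewrite potentialE 1?mulrC//.
by apply: ltW; near: y; exact: lt_nbhsr.
Unshelve. all: by end_near. Qed.

Lemma derive1_potential (s : R) : 0 < s ->
  derive1 (potential gamma) s = (gamma * s `^ (gamma - 1) - 1) / (gamma - 1).
Proof.
move=> s0; rewrite derive1E.
have D := near_eq_is_derive (near_potential s0)
  (is_deriveZ (gamma - 1)^-1 (is_deriveB (is_derive1_powR gamma s0) (is_derive_id s 1))).
by have [_ ->] := D; rewrite /GRing.scale/= mulrC.
Qed.

Lemma derive1n2_potential (s : R) : 0 < s ->
  derive1n 2 (potential gamma) s = gamma * s `^ (gamma - 2).
Proof.
move=> s0; rewrite /= derive1E.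
have E : \forall y \near s, (gamma - 1)^-1 * (gamma * y `^ (gamma - 1) - 1) =
    derive1 (potential gamma) y.
  near=> y; rewrite derive1_potential 1?mulrC//.
  by near: y; exact: lt_nbhsr.
have [_ ->] := near_eq_is_derive E (is_deriveZ (gamma - 1)^-1
  (is_deriveB (is_deriveZ gamma (is_derive1_powR (gamma - 1) s0))
   (is_derive_cst (1 : R^o) s 1))).
rewrite subr0 /GRing.scale/= -addrA -opprD; field.
by rewrite g1.
Unshelve. all: by end_near. Qed.

End potential.

(** * Properties of almost every time, and extensionality of the integrals *)

Section ae_time.
Context {R : realType}.
Implicit Types (T : R) (P Q : R -> Prop).

Lemma ae_timeS T P Q : (forall t, t \in `]0, T[ -> P t -> Q t) ->
  ae_time T P -> ae_time T Q.
Proof.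
move=> PQ; apply: (@filterS _ _ (ae_filter_ringOfSetsType _)) => t Pt tT.
exact: PQ (Pt tT).
Qed.

Lemma ae_timeI T P Q : ae_time T P -> ae_time T Q -> ae_time T (fun t => P t /\ Q t).
Proof.
apply: (@filterS2 _ _ (ae_filter_ringOfSetsType _)) => t Pt Qt tT.
by split; [exact: Pt|exact: Qt].
Qed.

Lemma ae_time_foralln T (P : nat -> R -> Prop) :
  (forall n, ae_time T (P n)) -> ae_time T (fun t => forall n, P n t).
Proof.
move=> H.
have H' := @ae_foralln _ _ _ (@lebesgue_measure R)
  (fun n t => t \in `]0, T[ -> P n t) H.
apply: (@filterS _ _ (ae_filter_ringOfSetsType _)) H' => t Pt tT n.
exact: Pt.
Qed.

(** The exceptional null set may depend on [a]. The values [T - 1/(n+1)] suffice, since every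
    [t < T] is below one of them, and countably many null sets have a null union. *)
Lemma ae_time_exhaust T P : 0 < T ->
  (forall a, a < T -> ae_time T (fun t => t < a -> P t)) -> ae_time T P.
Proof.
move=> T0 H.
have := @ae_time_foralln T (fun n t => t < T - n.+1%:R^-1 -> P t).
move=> /(_ _)/(ae_timeS _); apply => [t tT K|n]; last first.
  by apply: H; rewrite ltrBlDr ltrDl invr_gt0.
have tT' : 0 < T - t by move: tT; rewrite in_itv/= subr_gt0 => /andP[].
have [n _ nT] := near_infty_natSinv_lt (PosNum tT').
apply: (K n); rewrite ltrBrDr -ltrBrDl.
exact: (nT n (leqnn n)).
Qed.

End ae_time.

Section extensionality.
Context {R : realType}.
Implicit Types (f g : spacetime R -> R).

Lemma eq_int_Omega f g t : (forall q, Omega q -> f (t, q) = g (t, q)) ->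
  int_Omega f t = int_Omega g t.
Proof. by move=> fg; apply: eq_Rintegral => q /set_mem /fg. Qed.

Lemma eq_int_cyl f g tau :
  (forall t q, t \in `]0, tau[ -> Omega q -> f (t, q) = g (t, q)) ->
  int_cyl f tau = int_cyl g tau.
Proof. by move=> fg; apply: eq_Rintegral => -[t q] /set_mem[/= ? ?]; exact: fg. Qed.

Lemma eq_bracket f g tau : 0 < tau ->
  (forall t q, 0 <= t <= tau -> Omega q -> f (t, q) = g (t, q)) ->
  bracket f tau = bracket g tau.
Proof.
move=> tau0 fg; congr (_ - _); apply: eq_int_Omega => q; apply: fg.
  by rewrite lexx ltW.
by rewrite lexx ltW.
Qed.

End extensionality.

(** * Time cutoffs *)

Section cutoff.
Context {R : realType}.
Implicit Types (f : spacetime R -> R) (a b T : R).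

Definition cutoff a b f : spacetime R -> R := fun p => step a b p.1 * f p.

Lemma smooth_time : smooth (fst : spacetime R -> R).
Proof.
move=> k; have -> : (fst : spacetime R -> R) = (fst : {linear spacetime R -> R}) by [].
apply: is_Ck_linear => x; exact: cvg_fst.
Qed.

Lemma cutoff_test a b T f : a < b -> b < T -> smooth_periodic f ->
  test_function T (cutoff a b f).
Proof.
move=> ab bT [sf pf]; split; first split.
- apply: smoothM => //; apply: (@smooth_comp _ _ (step a b)).
    exact: smooth_step.
  exact: smooth_time.
- move=> t x1 x2 z; have [p1 p2 p3] := pf t x1 x2 z.
  by move: p1 p2 p3; rewrite /slice /cutoff /= => -> -> ->.
- by exists b => // t q bt; rewrite /cutoff step_ge ?mul0r.
Qed.

Lemma cutoff_le a b f p : a < b -> p.1 <= a -> cutoff a b f p = f p.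
Proof. by move=> ab pa; rewrite /cutoff step_le ?mul1r. Qed.

(** A derivative sees a neighbourhood of [p]; the strict inequality provides one on which the cutoff
    is identically 1. *)
Lemma cutoff_derive a b f p e : a < b -> p.1 < a ->
  'D_e (cutoff a b f) p = 'D_e f p.
Proof.
move=> ab pa; apply: near_eq_derive.
have : \forall q \near p, q.1 < a.
  have := @smooth_continuous _ _ _ smooth_time p.
  by move=> /(_ [set x | x < a]); apply; exact: lt_nbhsl.
by apply: filterS => q qa; rewrite cutoff_le// ltW.
Qed.

End cutoff.

(** This and the next lemma carry an equation for the cut-off test function over to the original
    one, term by term. *)
Lemma congr_eq (A : Type) (x x' y y' : A) : x = x' -> y = y' -> x' = y' -> x = y.
Proof. by move=> -> ->. Qed.

Lemma congr_balance (R : zmodType) (a a' b b' c c' d d' e e' : R) :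
  a = a' -> b = b' -> c = c' -> d = d' -> e = e' ->
  a' - b' - c' + d' - e' = 0 -> a - b - c + d - e = 0.
Proof. by move=> -> -> -> -> ->. Qed.

(* The weak formulations extend to test functions that do not vanish near
   t = T: for almost every tau < T one may cut off between tau and T. *)
Section smooth_tests.
Context {R : realType}.
Variables (gamma epsilon T : R) (rho : spacetime R -> R)
  (v : 'I_2 -> spacetime R -> R) (w : spacetime R -> R)
  (Gv : 'I_2 -> 'I_3 -> spacetime R -> R) (Gw : 'I_3 -> spacetime R -> R)
  (rho0 : space3 R -> R) (v0 : 'I_2 -> space3 R -> R) (w0 : space3 R -> R).
Hypothesis T_gt0 : 0 < T.
Hypothesis sol : dissipative_weak_solution gamma epsilon T rho v w Gv Gw rho0 v0 w0.

(** The cutoff equals 1 up to [a] and vanishes from the midpoint of [a] and [T] on. *)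
Let mid a : a < T -> a < (a + T) / 2 /\ (a + T) / 2 < T.
Proof. by move=> aT; split; lra. Qed.

Lemma continuity_smooth psi : smooth_periodic psi ->
  ae_time T (fun tau =>
      bracket (fun a => rho a * psi a) tau =
      int_cyl (fun a => rho a * dt psi a
                        + rho a * (\sum_(i < 2) v i a * dx i psi a)
                        + rho a * w a * dz psi a) tau).
Proof.
move=> spsi; apply: ae_time_exhaust => // a aT; have [ab bT] := mid aT.
apply: ae_timeS (dws_continuity sol (cutoff_test ab bT spsi)) => t tT H ta.
have t0 : 0 < t by move: tT; rewrite in_itv/= => /andP[].
have ct s f (q : space3 R) : s <= t -> cutoff a ((a + T) / 2) f (s, q) = f (s, q).
  by move=> st; rewrite cutoff_le//= (le_trans st)// ltW.
have cD s f e (q : space3 R) : s < t ->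
    'D_e (cutoff a ((a + T) / 2) f) (s, q) = 'D_e f (s, q).
  by move=> st; rewrite cutoff_derive//= (lt_trans st).
refine (congr_eq _ _ H).
  by apply: (eq_bracket t0) => s q /andP[_ st] _; rewrite ct.
apply: eq_int_cyl => s q /[!in_itv]/= /andP[_ st] _.
refine (congr2 _ (congr2 _ _ _) _).
- by rewrite /dt cD.
- by congr (_ * _); apply: eq_bigr => i _; rewrite /dx /ds cD.
- by rewrite /dz /ds cD.
Qed.

Lemma momentum_h_smooth (phi : 'I_2 -> spacetime R -> R) :
  (forall i, smooth_periodic (phi i)) ->
  ae_time T (fun tau =>
      bracket (fun a => rho a * (\sum_(i < 2) v i a * phi i a)) tau
      - int_cyl (fun a => rho a * (\sum_(i < 2) v i a * dt (phi i) a)) tau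
      - int_cyl (fun a =>
          rho a * (\sum_(i < 2) \sum_(j < 2) v i a * v j a * dx j (phi i) a)
          + rho a * w a * (\sum_(i < 2) v i a * dz (phi i) a)) tau
      + int_cyl (fun a =>
          \sum_(i < 2) \sum_(j < 3) Gv i j a * ds j (phi i) a) tau
      - int_cyl (fun a => pressure gamma (rho a) * div_x phi a) tau
      = 0).
Proof.
move=> sphi; apply: ae_time_exhaust => // a aT; have [ab bT] := mid aT.
have test i := cutoff_test ab bT (sphi i).
apply: ae_timeS (dws_momentum_h sol test) => t tT H ta.
have t0 : 0 < t by move: tT; rewrite in_itv/= => /andP[].
have ct s f (q : space3 R) : s <= t -> cutoff a ((a + T) / 2) f (s, q) = f (s, q).
  by move=> st; rewrite cutoff_le//= (le_trans st)// ltW.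
have cD s f e (q : space3 R) : s < t ->
    'D_e (cutoff a ((a + T) / 2) f) (s, q) = 'D_e f (s, q).
  by move=> st; rewrite cutoff_derive//= (lt_trans st).
refine (congr_balance _ _ _ _ _ H).
- apply: (eq_bracket t0) => s q /andP[_ st] _; congr (_ * _).
  by apply: eq_bigr => i _; rewrite ct.
- apply: eq_int_cyl => s q /[!in_itv]/= /andP[_ st] _; congr (_ * _).
  by apply: eq_bigr => i _; rewrite /dt cD.
- apply: eq_int_cyl => s q /[!in_itv]/= /andP[_ st] _; congr (_ * _ + _ * _).
    by apply: eq_bigr => i _; apply: eq_bigr => j _; rewrite /dx /ds cD.
  by apply: eq_bigr => i _; rewrite /dz /ds cD.
- apply: eq_int_cyl => s q /[!in_itv]/= /andP[_ st] _.
  by apply: eq_bigr => i _; apply: eq_bigr => j _; rewrite /ds cD.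
- apply: eq_int_cyl => s q /[!in_itv]/= /andP[_ st] _; congr (_ * _).
  by apply: eq_bigr => i _; rewrite /dx /ds cD.
Qed.

Lemma momentum_v_smooth phi : smooth_periodic phi ->
  ae_time T (fun tau =>
      epsilon ^+ 2 * bracket (fun a => rho a * w a * phi a) tau
      - epsilon ^+ 2 * int_cyl (fun a => rho a * w a * dt phi a) tau
      - epsilon ^+ 2 * int_cyl (fun a =>
          rho a * w a * (\sum_(i < 2) v i a * dx i phi a + w a * dz phi a)) tau
      + epsilon ^+ 2 * int_cyl (fun a =>
          \sum_(j < 3) Gw j a * ds j phi a) tau
      - int_cyl (fun a => pressure gamma (rho a) * dz phi a) tau
      = 0).
Proof.
move=> sphi; apply: ae_time_exhaust => // a aT; have [ab bT] := mid aT.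
apply: ae_timeS (dws_momentum_v sol (cutoff_test ab bT sphi)) => t tT H ta.
have t0 : 0 < t by move: tT; rewrite in_itv/= => /andP[].
have ct s f (q : space3 R) : s <= t -> cutoff a ((a + T) / 2) f (s, q) = f (s, q).
  by move=> st; rewrite cutoff_le//= (le_trans st)// ltW.
have cD s f e (q : space3 R) : s < t ->
    'D_e (cutoff a ((a + T) / 2) f) (s, q) = 'D_e f (s, q).
  by move=> st; rewrite cutoff_derive//= (lt_trans st).
refine (congr_balance (congr1 _ _) (congr1 _ _) (congr1 _ _) (congr1 _ _) _ H).
- by apply: (eq_bracket t0) => s q /andP[_ st] _; rewrite ct.
- by apply: eq_int_cyl => s q /[!in_itv]/= /andP[_ st] _; rewrite /dt cD.
- apply: eq_int_cyl => s q /[!in_itv]/= /andP[_ st] _; congr (_ * (_ + _)).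
    by apply: eq_bigr => i _; rewrite /dx /ds cD.
  by rewrite /dz /ds cD.
- apply: eq_int_cyl => s q /[!in_itv]/= /andP[_ st] _.
  by apply: eq_bigr => j _; rewrite /ds cD.
- by apply: eq_int_cyl => s q /[!in_itv]/= /andP[_ st] _; rewrite /dz /ds cD.
Qed.

End smooth_tests.

(** * Integrability of fields of finite energy *)

Section states.
Context d (X : measurableType d) (R : realType) (mu : {measure set X -> \bar R}).
Variables (gamma : R) (D : set X).

(* The integrability of the fields, on the space-time cylinder as well as on
   a time slice. *)
Record finite_energy (rho : X -> R) (v : 'I_2 -> X -> R) (w : X -> R) : Prop := {
  fe_measurable : measurable_fun D rho;
  fe_ge0 : forall x, D x -> 0 <= rho x;
  fe_rho : mu.-integrable D (EFin \o rho);
  fe_pow : mu.-integrable D (EFin \o (fun x => rho x `^ gamma));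
  fe_v : forall i, wL2 mu D rho (v i);
  fe_w : wL2 mu D rho w }.

Definition bounded_measurable (b : X -> R) :=
  measurable_fun D b /\ exists M : R, forall x, D x -> `|b x| <= M.

Hypothesis mD : measurable D.

(** As [gamma >= 1], one has [rho <= 1 + rho^gamma], and 1 is integrable on a set of finite measure;
    each velocity component is controlled by the whole kinetic term. *)
Lemma finite_energyP (rho : X -> R) (v : 'I_2 -> X -> R) (w : X -> R) :
  1 <= gamma -> (mu D < +oo)%E ->
  measurable_fun D rho -> (forall x, D x -> 0 <= rho x) ->
  mu.-integrable D (EFin \o (fun x => rho x `^ gamma)) ->
  (forall i, measurable_fun D (v i)) -> measurable_fun D w ->
  mu.-integrable D (EFin \o (fun x => rho x * (\sum_(i < 2) v i x ^+ 2 + w x ^+ 2))) ->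
  finite_energy rho v w.
Proof.
move=> g1 Dfin mrho rho0 ipow mv mw ikin; split => //.
- apply: (@rint_le _ _ _ _ _ mD _ (fun x => 1 + rho x `^ gamma)) => //.
    move=> x Dx; rewrite ger0_norm ?rho0//.
    have [r1|/ltW r1] := leP (rho x) 1; first by rewrite ler_wpDr// powR_ge0.
    by rewrite ler_wpDl//; exact: le1r_powR.
  by apply: rintD => //; exact: rint_cst.
- move=> i; split => //.
  apply: (rint_le _ _ _ ikin) => //.
    by apply: measurable_funM => //; exact: measurable_funX.
  move=> x Dx; rewrite (ger0_norm (mulr_ge0 (rho0 _ Dx) (sqr_ge0 _))).
  rewrite ler_wpM2l ?rho0// (bigD1 i)//= -addrA lerDl.
  by rewrite addr_ge0 ?sqr_ge0// sumr_ge0// => j _; exact: sqr_ge0.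
- split => //; apply: (rint_le _ _ _ ikin) => //.
    by apply: measurable_funM => //; exact: measurable_funX.
  move=> x Dx; rewrite (ger0_norm (mulr_ge0 (rho0 _ Dx) (sqr_ge0 _))).
  rewrite ler_wpM2l ?rho0// lerDr.
  by rewrite sumr_ge0// => j _; exact: sqr_ge0.
Qed.

Variables (rho : X -> R) (v : 'I_2 -> X -> R) (w : X -> R).
Hypothesis fe : finite_energy rho v w.
Local Notation rint f := (mu.-integrable D (EFin \o f)).
Implicit Types f g b : X -> R.

Lemma fe_bounded b : bounded_measurable b -> wL2 mu D rho b.
Proof. by move=> [mb [M bM]]; apply: wL2_bounded bM => //; case: fe. Qed.

Lemma fe_mulb f b : wL2 mu D rho f -> bounded_measurable b ->
  wL2 mu D rho (fun x => f x * b x).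
Proof. by move=> fL [mb [M bM]]; apply: wL2M bM. Qed.

Lemma fe_mul f g : wL2 mu D rho f -> wL2 mu D rho g ->
  rint (fun x => rho x * (f x * g x)).
Proof. by case: fe => *; exact: wL2_mul. Qed.

(** The constant 1 is taken as second factor; it has finite weighted norm because [rho] is
    integrable. *)
Lemma fe_int f : wL2 mu D rho f -> rint (fun x => rho x * f x).
Proof.
move=> fL; apply: (@eq_rint _ _ _ _ _ mD (fun x => rho x * (f x * 1))).
  by move=> x _; rewrite mulr1.
apply: fe_mul => //; apply: fe_bounded; split; first exact: measurable_cst.
by exists 1 => x _; rewrite normr1.
Qed.

Lemma fe_add f g : wL2 mu D rho f -> wL2 mu D rho g ->
  wL2 mu D rho (fun x => f x + g x).
Proof. by case: fe => *; exact: wL2D. Qed.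

Lemma fe_sum n (F : 'I_n -> X -> R) :
  (forall i, wL2 mu D rho (F i)) -> wL2 mu D rho (fun x => \sum_(i < n) F i x).
Proof. by case: fe => *; exact: wL2_sum. Qed.

Lemma fe_dot n (F G : 'I_n -> X -> R) :
  (forall i, wL2 mu D rho (F i)) -> (forall i, wL2 mu D rho (G i)) ->
  rint (fun x => rho x * (\sum_(i < n) F i x * G i x)).
Proof.
move=> LF LG.
apply: (@eq_rint _ _ _ _ _ mD (fun x => \sum_(i < n) rho x * (F i x * G i x))).
  by move=> x _; rewrite mulr_sumr.
by apply: rint_sum => // i; exact: fe_mul.
Qed.

End states.

Lemma finite_energyS d (X : measurableType d) (R : realType)
    (mu : {measure set X -> \bar R}) (gamma : R) (D E : set X) rho v w :
  measurable D -> measurable E -> E `<=` D ->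
  finite_energy mu gamma D rho v w -> finite_energy mu gamma E rho v w.
Proof.
move=> mD mE ED [mrho r0 ir ip Lv Lw].
have LS f : wL2 mu D rho f -> wL2 mu E rho f.
  by move=> [mf fi]; split; [exact: measurable_funS mf|exact: integrableS fi].
split=> //.
- exact: measurable_funS mrho.
- by move=> x /ED; exact: r0.
- exact: integrableS ir.
- exact: integrableS ip.
- by move=> i; exact: LS.
- exact: LS.
Qed.

(** * Integrability of the solution on cylinders, on almost every slice and at time 0 *)

Section bounded_continuous.
Context {R : realType}.
Implicit Types f : spacetime R -> R.

Lemma bounded_measurable_cylinder (tau : R) f : continuous f ->
  @bounded_measurable _
    (measurableTypeR R *
      (measurableTypeR R * measurableTypeR R * measurableTypeR R))%type R (cylinder `]0, tau[) f.
Proof.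
move=> cf; split.
  by apply: measurable_funTS; exact: continuous_measurable_spacetime.
have [M bM] := bounded_cylinder tau cf.
exists M => -[t q] [/= tT Oq]; apply: bM => //.
exact: subset_itv_oo_cc tT.
Qed.

Lemma bounded_measurable_slice (tau t : R) f : continuous f -> t \in `[0, tau] ->
  @bounded_measurable _ (measurableTypeR R * measurableTypeR R * measurableTypeR R)%type
    R (@Omega R) (slice f t).
Proof.
move=> cf tT; split.
  apply: measurable_funTS; apply: continuous_measurable_space.
  exact: continuous_slice.
by have [M bM] := bounded_cylinder tau cf; exists M => q Oq; exact: bM.
Qed.

End bounded_continuous.

Section solution_integrability.
Context {R : realType}.
Variables (gamma epsilon T : R) (rho : spacetime R -> R)
  (v : 'I_2 -> spacetime R -> R) (w : spacetime R -> R)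
  (Gv : 'I_2 -> 'I_3 -> spacetime R -> R) (Gw : 'I_3 -> spacetime R -> R)
  (rho0 : space3 R -> R) (v0 : 'I_2 -> space3 R -> R) (w0 : space3 R -> R).
Hypothesis gamma_gt1 : 1 < gamma.
Hypothesis T_gt0 : 0 < T.
Hypothesis sol : dissipative_weak_solution gamma epsilon T rho v w Gv Gw rho0 v0 w0.

(** By Tonelli: a bound on the slices that is uniform in time is integrable over a bounded time
    interval. *)
Lemma integrable_Linf_Lp (p : R) (f : spacetime R -> R) :
  (forall t q, t \in `[0, T] -> 0 <= f (t, q)) -> in_Linf_Lp T p f ->
  (@mu_spacetime R).-integrable (cylinder `]0, T[) (EFin \o (fun a => f a `^ p)).
Proof.
move=> f0 [mf [C bC]].
have E (a : spacetime R) : cylinder `]0, T[ a -> `|f a| `^ p = f a `^ p.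
  case: a => t q [/= tT _]; rewrite ger0_norm// f0//; exact: subset_itv_oo_cc tT.
apply: (@eq_rint _ _ _ (@mu_spacetime R) _ (measurable_cylinder `]0, T[)
  (fun a => `|f a| `^ p)) => //.
apply: (@integrable_cylinder_bounded _ _ _ C).
- apply: (@measurableT_comp _ _ _ _ _ _ (fun x : R => x `^ p)).
    exact: measurable_powR.
  exact: measurableT_comp.
- by move=> a _; exact: powR_ge0.
- exact: bC.
Qed.

Let kinetic (a : spacetime R) := rho a * (\sum_(i < 2) v i a ^+ 2 + w a ^+ 2).

Let kinetic_ge0 t q : t \in `[0, T] -> 0 <= kinetic (t, q).
Proof.
move=> tT; rewrite mulr_ge0 ?(dws_rho_ge0 sol)// addr_ge0 ?sqr_ge0//.
by rewrite sumr_ge0// => i _; exact: sqr_ge0.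
Qed.

Let int_kinetic :
  (@mu_spacetime R).-integrable (cylinder `]0, T[) (EFin \o kinetic).
Proof.
(* The kinetic bound has exponent 1, and this power is harmless for a nonnegative base. *)
apply: (@eq_rint _ _ _ (@mu_spacetime R) _ (measurable_cylinder `]0, T[)
  (fun a => kinetic a `^ 1)).
  move=> -[t q] [/= tT _]; rewrite powRr1// kinetic_ge0//.
  exact: subset_itv_oo_cc tT.
exact: integrable_Linf_Lp kinetic_ge0 (dws_kinetic sol).
Qed.

Let int_pow :
  (@mu_spacetime R).-integrable (cylinder `]0, T[) (EFin \o (fun a => rho a `^ gamma)).
Proof.
exact: integrable_Linf_Lp (fun t q => @dws_rho_ge0 _ _ _ _ _ _ _ _ _ _ _ _ sol t q)
  (dws_rho_Lgamma sol).
Qed.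

Let mv i : measurable_fun (cylinder `]0, T[) (v i).
Proof. by have [] := dws_v_H1 sol i. Qed.

Let mw : measurable_fun (cylinder `]0, T[) w.
Proof. by have [] := dws_w_H1 sol. Qed.

Let mrho : measurable_fun (cylinder `]0, T[) rho.
Proof. by have [] := dws_rho_Lgamma sol. Qed.

Lemma finite_energy_cylinder tau : tau <= T ->
  finite_energy (@mu_spacetime R) gamma (cylinder `]0, tau[) rho v w.
Proof.
move=> tauT; apply: (@finite_energyS _ _ _ (@mu_spacetime R) _ (cylinder `]0, T[)).
- exact: measurable_cylinder.
- exact: measurable_cylinder.
- move=> -[t q] [/= tt Oq]; split=> //=; move: tt; rewrite !in_itv/= => /andP[-> tt].
  exact: lt_le_trans tauT.
apply: finite_energyP.
- exact: measurable_cylinder.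
- exact: ltW.
- exact: mu_cylinder_fin.
- exact: mrho.
- move=> -[t q] [/= tT _]; apply: (dws_rho_ge0 sol); exact: subset_itv_oo_cc tT.
- exact: int_pow.
- exact: mv.
- exact: mw.
- exact: int_kinetic.
Qed.

(** Fubini turns integrability on the cylinder into integrability on almost every slice. *)
Lemma finite_energy_slice : ae_time T (fun t =>
  finite_energy (@mu_space R) gamma (@Omega R)
    (slice rho t) (fun i => slice (v i) t) (slice w t)).
Proof.
have := ae_timeI (ae_integrable_cylinder int_pow) (ae_integrable_cylinder int_kinetic).
apply: ae_timeS => t tT [ip ik]; apply: finite_energyP.
- exact: measurable_Omega.
- exact: ltW.
- exact: mu_Omega_fin.
- exact: measurable_slice_cylinder mrho tT.
- move=> q _; apply: (dws_rho_ge0 sol); exact: subset_itv_oo_cc tT.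
- exact: ip.
- move=> i; exact: measurable_slice_cylinder (mv i) tT.
- exact: measurable_slice_cylinder mw tT.
- exact: ik.
Qed.

(** The slice at time 0 cannot be reached from almost every time; its integrability comes from the
    conditions on the initial data. *)
Lemma finite_energy_init :
  finite_energy (@mu_space R) gamma (@Omega R)
    (slice rho 0) (fun i => slice (v i) 0) (slice w 0).
Proof.
have T0 : 0 \in `[0, T] by rewrite in_itv/= lexx ltW.
apply: finite_energyP.
- exact: measurable_Omega.
- exact: ltW.
- exact: mu_Omega_fin.
- exact: rint_measurable ((dws_rho_C sol).1 0 T0).
- by move=> q _; apply: (dws_rho_ge0 sol).
- exact: (dws_rho_init_Lgamma sol).
- exact: (dws_v_init_meas sol).
- exact: (dws_w_init_meas sol).
- exact: (dws_kinetic_init sol).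
Qed.

(* With unit density, wL2 is the unweighted L^2. *)
Lemma gradient_L2 tau (f : spacetime R -> R) (G : 'I_3 -> spacetime R -> R) j :
  tau <= T -> in_L2H1 T f G ->
  wL2 (@mu_spacetime R) (cylinder `]0, tau[) (fun=> 1) (G j).
Proof.
move=> tauT [mf mG _ iG].
have sub : cylinder `]0, tau[ `<=` @cylinder R `]0, T[.
  move=> -[t q] [/= tt Oq]; split=> //=; move: tt; rewrite !in_itv/= => /andP[-> tt].
  exact: lt_le_trans tauT.
have mT := measurable_cylinder `]0, T[.
have mt := measurable_cylinder `]0, tau[.
split; first exact: (measurable_funS mT sub (mG j)).
apply: (@integrableS _ _ _ (@mu_spacetime R) _ _ _ mT mt sub).
apply: (@rint_le _ _ _ (@mu_spacetime R) _ mT _ _ _ _ iG).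
  by apply: measurable_funM => //; apply: measurable_funX; exact: mG.
move=> a _; rewrite mul1r ger0_norm ?sqr_ge0//.
rewrite (bigD1 j)//= addrCA lerDl.
by rewrite addr_ge0 ?sqr_ge0// sumr_ge0// => k _; exact: sqr_ge0.
Qed.

End solution_integrability.

(** * Linearity of the integrals over the cell and the cylinder *)

Section linearity.
Context {R : realType}.
Implicit Types (f g : spacetime R -> R).

Definition integrable_cyl (tau : R) f :=
  (@mu_spacetime R).-integrable (cylinder `]0, tau[) (EFin \o f).

Definition integrable_slice (t : R) f :=
  (@mu_space R).-integrable (@Omega R) (EFin \o slice f t).

Lemma int_cylD tau f g : integrable_cyl tau f -> integrable_cyl tau g ->
  int_cyl (fun a => f a + g a) tau = int_cyl f tau + int_cyl g tau.
Proof.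
exact: (@RintegralD _ _ _ (@mu_spacetime R) _ _ _ (measurable_cylinder `]0, tau[)).
Qed.

Lemma int_cylB tau f g : integrable_cyl tau f -> integrable_cyl tau g ->
  int_cyl (fun a => f a - g a) tau = int_cyl f tau - int_cyl g tau.
Proof.
exact: (@RintegralB _ _ _ (@mu_spacetime R) _ _ _ (measurable_cylinder `]0, tau[)).
Qed.

Lemma int_cylZ tau f (c : R) : integrable_cyl tau f ->
  int_cyl (fun a => c * f a) tau = c * int_cyl f tau.
Proof.
exact: (@RintegralZl _ _ _ (@mu_spacetime R) _ _ _ (measurable_cylinder `]0, tau[)).
Qed.

Lemma int_OmegaD t f g : integrable_slice t f -> integrable_slice t g ->
  int_Omega (fun a => f a + g a) t = int_Omega f t + int_Omega g t.
Proof.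
exact: (@RintegralD _ _ _ (@mu_space R) _ _ _ measurable_Omega).
Qed.

Lemma int_OmegaB t f g : integrable_slice t f -> integrable_slice t g ->
  int_Omega (fun a => f a - g a) t = int_Omega f t - int_Omega g t.
Proof.
exact: (@RintegralB _ _ _ (@mu_space R) _ _ _ measurable_Omega).
Qed.

Lemma int_OmegaZ t f (c : R) : integrable_slice t f ->
  int_Omega (fun a => c * f a) t = c * int_Omega f t.
Proof.
exact: (@RintegralZl _ _ _ (@mu_space R) _ _ _ measurable_Omega).
Qed.

Lemma integrable_cylD tau f g : integrable_cyl tau f -> integrable_cyl tau g ->
  integrable_cyl tau (fun a => f a + g a).
Proof. exact: (@rintD _ _ _ (@mu_spacetime R) _ (measurable_cylinder `]0, tau[)). Qed.

Lemma integrable_cylB tau f g : integrable_cyl tau f -> integrable_cyl tau g ->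
  integrable_cyl tau (fun a => f a - g a).
Proof. exact: (@rintB _ _ _ (@mu_spacetime R) _ (measurable_cylinder `]0, tau[)). Qed.

Lemma integrable_cylZ tau f (c : R) : integrable_cyl tau f ->
  integrable_cyl tau (fun a => c * f a).
Proof. exact: (@rintZ _ _ _ (@mu_spacetime R) _ (measurable_cylinder `]0, tau[)). Qed.

Lemma integrable_cyl_sum tau n (F : 'I_n -> spacetime R -> R) :
  (forall i, integrable_cyl tau (F i)) ->
  integrable_cyl tau (fun a => \sum_(i < n) F i a).
Proof. exact: (@rint_sum _ _ _ (@mu_spacetime R) _ (measurable_cylinder `]0, tau[)). Qed.

Lemma eq_integrable_cyl tau f g :
  (forall t q, t \in `]0, tau[ -> Omega q -> f (t, q) = g (t, q)) ->
  integrable_cyl tau f -> integrable_cyl tau g.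
Proof.
move=> fg; apply: (@eq_rint _ _ _ (@mu_spacetime R) _ (measurable_cylinder `]0, tau[)).
by move=> -[t q] [/= ? ?]; exact: fg.
Qed.

Lemma integrable_sliceD t f g : integrable_slice t f -> integrable_slice t g ->
  integrable_slice t (fun a => f a + g a).
Proof. exact: (@rintD _ _ _ (@mu_space R) _ measurable_Omega). Qed.

Lemma integrable_sliceB t f g : integrable_slice t f -> integrable_slice t g ->
  integrable_slice t (fun a => f a - g a).
Proof. exact: (@rintB _ _ _ (@mu_space R) _ measurable_Omega). Qed.

Lemma integrable_sliceZ t f (c : R) : integrable_slice t f ->
  integrable_slice t (fun a => c * f a).
Proof. exact: (@rintZ _ _ _ (@mu_space R) _ measurable_Omega). Qed.

Lemma eq_integrable_slice t f g :
  (forall q, Omega q -> f (t, q) = g (t, q)) ->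
  integrable_slice t f -> integrable_slice t g.
Proof. exact: (@eq_rint _ _ _ (@mu_space R) _ measurable_Omega). Qed.

End linearity.

(** * Algebraic identities between integrals and between integrands *)

Section algebra.
Context {R : realType}.

(** The final addition. At times [tau] (index 1) and 0, [E] is the energy, [M] and [N] are the
    momenta tested with [V] and [W], [Q] is the mass tested with [entropy_test], and [S] is the
    integral of [r^gamma]. The [I] and [J] are the integrals of the two momentum equations, with
    [J4] the vertical pressure term; [K] and [L] are the increments of [Q] and [S]. *)
Lemma balance (E1 E0 M1 M0 N1 N0 Q1 Q0 S1 S0 Diss A I1 I2 I3 I4 J1 J2 J3 J4
    K L B C D e2 RE1 RE0 : R) :
  RE1 = E1 - M1 - e2 * N1 + Q1 + S1 ->
  RE0 = E0 - M0 - e2 * N0 + Q0 + S0 ->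
  (E1 - E0) + Diss <= 0 ->
  (M1 - M0) - I1 - I2 + I3 - I4 = 0 ->
  e2 * (N1 - N0) - e2 * J1 - e2 * J2 + e2 * J3 - J4 = 0 ->
  J4 = 0 -> Q1 - Q0 = K -> S1 - S0 = L -> A = Diss - I3 ->
  B + e2 * C - D = K + L - I1 - I2 - e2 * J1 - e2 * J2 ->
  (RE1 - RE0) + A <= B + e2 * C + e2 * J3 - D - I4.
Proof.
move=> -> -> HE HM HN J40 HQ HS -> HB; rewrite J40 subr0 in HN.
have -> : B + e2 * C + e2 * J3 - D - I4 = (B + e2 * C - D) + e2 * J3 - I4 by ring.
by rewrite HB; rewrite mulrBr in HN; lra.
Qed.

(** The material derivative of half the squares, contributed by the continuity equation, gives [V]
    times the material derivative of [V]; the momentum equation subtracts [v] times it, leaving the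
    factor [V - v], and likewise for [W]. Here [p2] is [P''(r)], the term [r * p2 * rt] is the time
    derivative of [r^gamma], and [p2 * 0] holds the place of the vertical derivative of [r]. *)
Lemma integrand_identity (rho w W Wt Wz r rt p2 e2 : R)
    (v V Vt Vz Wx rx : 'I_2 -> R) (Vx : 'I_2 -> 'I_2 -> R) :
  rho * (\sum_(i < 2) (Vt i + \sum_(j < 2) v j * Vx i j + w * Vz i) * (V i - v i))
  + e2 * (rho * (Wt + \sum_(i < 2) v i * Wx i + w * Wz) * (W - w))
  - p2 * ((rho - r) * rt + rho * (\sum_(i < 2) v i * rx i)) =
  (rho * (\sum_(i < 2) V i * Vt i + e2 * (W * Wt) - p2 * rt)
   + rho * (\sum_(j < 2) v j *
       (\sum_(i < 2) V i * Vx i j + e2 * (W * Wx j) - p2 * rx j))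
   + rho * w * (\sum_(i < 2) V i * Vz i + e2 * (W * Wz) - p2 * 0))
  + r * p2 * rt
  - rho * (\sum_(i < 2) v i * Vt i)
  - (rho * (\sum_(i < 2) \sum_(j < 2) v i * v j * Vx i j)
     + rho * w * (\sum_(i < 2) v i * Vz i))
  - e2 * (rho * w * Wt)
  - e2 * (rho * w * (\sum_(i < 2) v i * Wx i + w * Wz)).
Proof. by rewrite !big_ord_recl !big_ord0 /=; ring. Qed.

(** Puts the convective flux in the form of a weighted scalar product of two square-integrable
    fields, which gives its integrability. *)
Lemma flux_identity (rho w : R) (v Vz : 'I_2 -> R) (Vx : 'I_2 -> 'I_2 -> R) :
  rho * (\sum_(i < 2) (\sum_(j < 2) v j * Vx i j + w * Vz i) * v i) =
  rho * (\sum_(i < 2) \sum_(j < 2) v i * v j * Vx i j)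
  + rho * w * (\sum_(i < 2) v i * Vz i).
Proof. by rewrite !big_ord_recl !big_ord0 /=; ring. Qed.

(** Separates the part carrying the factor [rho], integrable by the weighted theory, from a part
    that is continuous. *)
Lemma pressure_identity (rho r p x y : R) :
  rho * ((x + y) * p) - p * (r * x) = p * ((rho - r) * x + rho * y).
Proof. by ring. Qed.

(** Meant for [gm = gamma - 1], [pr = gamma r^(gamma - 1)] and [rg = r^gamma]: then [(pr - 1) / gm]
    is [P'(r)], [(rg - r) / gm] is [P(r)], and the last term is [r P'(r) - P(r)]. *)
Lemma density_identity (rho r P pr rg e2 w W gm : R) (v V : 'I_2 -> R) :
  gm != 0 ->
  2^-1 * rho * (\sum_(i < 2) (v i - V i) ^+ 2)
    + e2 / 2 * rho * (w - W) ^+ 2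
    + (P - (pr - 1) / gm * (rho - r) - (rg - r) / gm) =
  (2^-1 * rho * (\sum_(i < 2) v i ^+ 2) + e2 / 2 * rho * w ^+ 2 + P)
  - rho * (\sum_(i < 2) v i * V i) - e2 * (rho * w * W)
  + rho * (\sum_(i < 2) 2^-1 * (V i * V i) + e2 / 2 * (W * W) - (pr - 1) / gm)
  + (r * pr - rg) / gm.
Proof. by move=> gm0; rewrite !big_ord_recl !big_ord0 /=; field. Qed.

End algebra.

(** * The clipped density and the test function of the continuity equation *)

Section test_functions.
Context {R : realType}.
Variables (gamma epsilon T : R) (r : spacetime R -> R) (V : 'I_2 -> spacetime R -> R)
  (W : spacetime R -> R) (c : R).
Hypotheses (gamma_gt1 : 1 < gamma) (c_gt0 : 0 < c).
Hypothesis r_gt : forall t q, t \in `[0, T] -> Omega q -> c < r (t, q).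
Hypotheses (sr : smooth_periodic r) (sV : forall i, smooth_periodic (V i))
  (sW : smooth_periodic W).

Definition clipped : spacetime R -> R := posclip c \o r.

Lemma clipped_gt0 a : 0 < clipped a.
Proof. exact: posclip_gt0. Qed.

Lemma smooth_clipped : smooth clipped.
Proof. by apply: smooth_comp; [exact: smooth_posclip|case: sr]. Qed.

Lemma clippedE t q : t \in `[0, T] -> Omega q -> clipped (t, q) = r (t, q).
Proof. by move=> tT Oq; apply: posclip_id => //; apply/ltW/r_gt. Qed.

(** The strict bound [c < r] persists on a full neighbourhood of the point, also across the time
    endpoints and the boundary of the cell. *)
Lemma clipped_derive t q e : t \in `[0, T] -> Omega q ->
  'D_e clipped (t, q) = 'D_e r (t, q).
Proof.
move=> tT Oq; apply: near_eq_derive.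
have cr : continuous r by apply: smooth_continuous; case: sr.
have : \forall p \near (t, q), c < r p.
  by apply: (cr (t, q) [set x | c < x]); apply: lt_nbhsr; exact: r_gt.
by apply: filterS => p cp; apply: posclip_id => //; exact: ltW.
Qed.

(** The last term is the closed form of [P'] at the clipped density, which is smooth on all of
    space-time. *)
Definition entropy_test : spacetime R -> R := fun a =>
  \sum_(i < 2) 2^-1 * (V i a * V i a) + epsilon ^+ 2 / 2 * (W a * W a)
  - (gamma * clipped a `^ (gamma - 1) - 1) / (gamma - 1).

Lemma smooth_entropy_test : smooth entropy_test.
Proof.
have sc (x : R) : smooth (cst x : spacetime R -> R) by exact: smooth_cst.
have -> : entropy_test =
  ((fun a => \sum_(i < 2) 2^-1 * (V i a * V i a)) \+
   (cst (epsilon ^+ 2 / 2) \* (W \* W))) \+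
   ((cst (- (gamma / (gamma - 1))) \* (fun a => clipped a `^ (gamma - 1)))
    \+ cst (gamma - 1)^-1).
  apply/funext => a; rewrite /entropy_test /=; congr (_ + _).
  by rewrite mulrBl mul1r opprB mulNr addrC mulrAC.
have [sW' _] := sW.
have s1 : smooth (fun a => \sum_(i < 2) 2^-1 * (V i a * V i a)).
  apply: smooth_sum => i; have [sVi _] := sV i.
  by apply: smoothM; [exact: sc|exact: smoothM].
apply: smoothD; apply: smoothD.
- exact: s1.
- by apply: smoothM; [exact: sc|exact: smoothM].
- apply: smoothM; first exact: sc.
  by apply: smooth_powR; [exact: clipped_gt0|exact: smooth_clipped].
- exact: sc.
Qed.

Lemma periodic_entropy_test : periodic_st entropy_test.
Proof.
move=> t x1 x2 z; rewrite /slice /entropy_test /clipped /=.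
have [_ pr] := sr; have [_ pW] := sW.
have pV i := (sV i).2.
have [r1 r2 r3] := pr t x1 x2 z; have [w1 w2 w3] := pW t x1 x2 z.
move: r1 r2 r3 w1 w2 w3; rewrite /slice => -> -> -> -> -> ->.
split; congr (_ + _ - _); apply: eq_bigr => i _;
  have [] := pV i t x1 x2 z; rewrite /slice; by [move=> -> _ _|move=> _ -> _|move=> _ _ ->].
Qed.

(** The factor [gamma * clipped a ^ (gamma - 2)] is [P''] of the clipped density. *)
Lemma entropy_test_derive a e :
  'D_e entropy_test a = \sum_(i < 2) V i a * 'D_e (V i) a
    + epsilon ^+ 2 * (W a * 'D_e W a)
    - gamma * clipped a `^ (gamma - 2) * 'D_e clipped a.
Proof.
have sqD (f : spacetime R -> R) : smooth f ->
    is_derive a e (fun a => f a * f a) (2 * (f a * 'D_e f a)).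
  move=> sf; have D := derivableP (smooth_derivable (a := a) (e := e) sf).
  apply: (is_derive_eq (is_deriveM D D)).
  by rewrite /GRing.scale/= -mulr2n mulr_natl.
have DV : is_derive a e (fun a => \sum_(i < 2) 2^-1 * (V i a * V i a))
    (\sum_(i < 2) V i a * 'D_e (V i) a).
  have DVi i : is_derive a e (fun a => 2^-1 * (V i a * V i a)) (V i a * 'D_e (V i) a).
    apply: (is_derive_eq (is_deriveZ 2^-1 (sqD (V i) (sV i).1))).
    by rewrite /GRing.scale/= mulKf ?pnatr_eq0.
  have -> : (fun a => \sum_(i < 2) 2^-1 * (V i a * V i a)) =
      \sum_(i < 2) (fun a => 2^-1 * (V i a * V i a)).
    by apply/funext => b; rewrite fct_sumE.
  exact: is_derive_sum.
have DW := is_deriveZ (epsilon ^+ 2 / 2) (sqD W sW.1).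
have DP := is_derive_powR_line (gamma - 1) (clipped_gt0 a)
  (smooth_derivable (a := a) (e := e) smooth_clipped).
have DQ := is_deriveZ (gamma - 1)^-1 (is_deriveB (is_deriveZ gamma DP)
  (is_derive_cst (1 : R^o) a e)).
have [_] := is_deriveB (is_deriveD DV DW) DQ.
have -> : ((fun a => \sum_(i < 2) 2^-1 * (V i a * V i a))
   + (epsilon ^+ 2 / 2) *: (fun a => W a * W a)
   - (gamma - 1)^-1 *: (gamma *: (fun b => clipped b `^ (gamma - 1)) - cst 1)) = entropy_test.
  apply/funext => b; rewrite /entropy_test; congr (_ + _ - _).
  by rewrite [in RHS]mulrC.
move=> ->; rewrite /GRing.scale/= subr0.
have g0 : gamma - 1 != 0 by rewrite gt_eqF// subr_gt0.
have -> : gamma - 1 - 1 = gamma - 2 by rewrite -addrA -opprD.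
congr (_ + _ - _); first by field.
by field.
Qed.

(** Written as [r P''(r)] times the derivative of [r], the form in which it combines with the terms
    containing [P'']. *)
Lemma clipped_pow_derive a e : 'D_e (fun b => clipped b `^ gamma) a =
  clipped a * (gamma * clipped a `^ (gamma - 2)) * 'D_e clipped a.
Proof.
have [_ ->] := is_derive_powR_line gamma (clipped_gt0 a)
  (smooth_derivable (a := a) (e := e) smooth_clipped).
have -> : clipped a `^ (gamma - 1) = clipped a * clipped a `^ (gamma - 2).
  have -> : gamma - 2 = gamma - 1 - 1 by rewrite -addrA -opprD.
  by rewrite mulr_powRB1 ?subr_gt0// ltW// clipped_gt0.
by ring.
Qed.

End test_functions.

(** * The weighted space L^2 on the cylinder *)

Section cylinder_class.
Context {R : realType}.
Variables (gamma tau : R) (rho : spacetime R -> R)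
  (v : 'I_2 -> spacetime R -> R) (w : spacetime R -> R).
Hypothesis fe : finite_energy (@mu_spacetime R) gamma (cylinder `]0, tau[) rho v w.
Implicit Types f g b : spacetime R -> R.

Definition cylL2 f := wL2 (@mu_spacetime R) (cylinder `]0, tau[) rho f.

Lemma cylL2_v i : cylL2 (v i). Proof. exact: fe_v fe i. Qed.

Lemma cylL2_w : cylL2 w. Proof. exact: fe_w fe. Qed.

Lemma cylL2_smooth b : smooth b -> cylL2 b.
Proof.
move=> /smooth_continuous/(bounded_measurable_cylinder tau).
exact: (@fe_bounded _ _ _ (@mu_spacetime R) _ _ (measurable_cylinder _) _ _ _ fe).
Qed.

Lemma cylL2M f b : cylL2 f -> smooth b -> cylL2 (fun a => f a * b a).
Proof.
move=> fL /smooth_continuous/(bounded_measurable_cylinder tau).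
exact: (@fe_mulb _ _ _ (@mu_spacetime R) _ (measurable_cylinder _)).
Qed.

Lemma cylL2D f g : cylL2 f -> cylL2 g -> cylL2 (fun a => f a + g a).
Proof.
exact: (@fe_add _ _ _ (@mu_spacetime R) _ _ (measurable_cylinder _) _ _ _ fe).
Qed.

Lemma cylL2N f : cylL2 f -> cylL2 (fun a => - f a).
Proof. exact: (@wL2N _ _ _ (@mu_spacetime R) _ (measurable_cylinder _)). Qed.

Lemma cylL2_sum n (F : 'I_n -> spacetime R -> R) :
  (forall i, cylL2 (F i)) -> cylL2 (fun a => \sum_(i < n) F i a).
Proof.
exact: (@fe_sum _ _ _ (@mu_spacetime R) _ _ (measurable_cylinder _) _ _ _ fe).
Qed.

Lemma cylL2_integrable f : cylL2 f -> integrable_cyl tau (fun a => rho a * f a).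
Proof.
exact: (@fe_int _ _ _ (@mu_spacetime R) _ _ (measurable_cylinder _) _ _ _ fe).
Qed.

Lemma cylL2_mul f g : cylL2 f -> cylL2 g ->
  integrable_cyl tau (fun a => rho a * (f a * g a)).
Proof.
exact: (@fe_mul _ _ _ (@mu_spacetime R) _ _ (measurable_cylinder _) _ _ _ fe).
Qed.

Lemma cylL2_dot n (F G : 'I_n -> spacetime R -> R) :
  (forall i, cylL2 (F i)) -> (forall i, cylL2 (G i)) ->
  integrable_cyl tau (fun a => rho a * (\sum_(i < n) F i a * G i a)).
Proof.
exact: (@fe_dot _ _ _ (@mu_spacetime R) _ _ (measurable_cylinder _) _ _ _ fe).
Qed.

(** A material derivative of a smooth function is affine in the velocity, with coefficients bounded
    on the cylinder. *)
Lemma cylL2_material f : smooth f -> cylL2 (material v w f).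
Proof.
move=> sf; apply: cylL2D; last exact: cylL2M cylL2_w (smooth_derive _ sf).
apply: cylL2D; first exact: cylL2_smooth (smooth_derive _ sf).
apply: cylL2_sum => i; exact: cylL2M (cylL2_v i) (smooth_derive _ sf).
Qed.

End cylinder_class.

(** * Decomposition of the relative energy at a fixed time *)

Section relative_energy_slice.
Context {R : realType}.
Variables (gamma epsilon T : R) (rho : spacetime R -> R)
  (v : 'I_2 -> spacetime R -> R) (w : spacetime R -> R)
  (r : spacetime R -> R) (V : 'I_2 -> spacetime R -> R)
  (W : spacetime R -> R) (c : R).
Hypotheses (gamma_gt1 : 1 < gamma) (c_gt0 : 0 < c).
Hypothesis r_gt : forall t q, t \in `[0, T] -> Omega q -> c < r (t, q).
Hypotheses (sr : smooth_periodic r) (sV : forall i, smooth_periodic (V i))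
  (sW : smooth_periodic W).
Variable t : R.
Hypothesis tT : t \in `[0, T].
Hypothesis fe : finite_energy (@mu_space R) gamma (@Omega R)
  (slice rho t) (fun i => slice (v i) t) (slice w t).

Local Notation psi := (entropy_test gamma epsilon r V W c).

Let bm f : continuous f ->
  @bounded_measurable _ (measurableTypeR R * measurableTypeR R * measurableTypeR R)%type
    R (@Omega R) (slice f t).
Proof. by move=> cf; exact: bounded_measurable_slice cf tT. Qed.

Let sL2 f := wL2 (@mu_space R) (@Omega R) (slice rho t) (slice f t).

Let sL2_continuous b : continuous b -> sL2 b.
Proof.
move=> cb.
exact: (@fe_bounded _ _ _ (@mu_space R) _ _ measurable_Omega _ _ _ fe _ (bm cb)).
Qed.


(** Expansion of the squares: the terms on the right are the energy, the brackets of the momentum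
    and continuity equations, and the integral of [r^gamma]. *)
Lemma relative_energyE :
  relative_energy gamma epsilon rho v w r V W t =
  int_Omega (fun a => 2^-1 * rho a * (\sum_(i < 2) v i a ^+ 2)
        + epsilon ^+ 2 / 2 * rho a * w a ^+ 2
        + potential gamma (rho a)) t
  - int_Omega (fun a => rho a * (\sum_(i < 2) v i a * V i a)) t
  - epsilon ^+ 2 * int_Omega (fun a => rho a * w a * W a) t
  + int_Omega (fun a => rho a * psi a) t
  + int_Omega (fun a => clipped r c a `^ gamma) t.
Proof.
have g0 : gamma - 1 != 0 by rewrite gt_eqF// subr_gt0.
have rho_ge0 q : Omega q -> 0 <= rho (t, q) by exact: (fe_ge0 fe).
have iE : integrable_slice t (fun a => 2^-1 * rho a * (\sum_(i < 2) v i a ^+ 2)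
        + epsilon ^+ 2 / 2 * rho a * w a ^+ 2 + potential gamma (rho a)).
  apply: (@eq_integrable_slice _ _ (fun a =>
     2^-1 * (\sum_(i < 2) rho a * v i a ^+ 2) + epsilon ^+ 2 / 2 * (rho a * w a ^+ 2)
     + (gamma - 1)^-1 * (rho a `^ gamma - rho a))).
    move=> q Oq; rewrite potentialE ?rho_ge0//.
    refine (congr2 _ (congr2 _ _ _) _).
    - by rewrite -mulr_sumr mulrA.
    - by rewrite mulrA.
    - by rewrite mulrC.
  apply: integrable_sliceD; first apply: integrable_sliceD.
  - apply: integrable_sliceZ.
    apply: (@rint_sum _ _ _ (@mu_space R) _ measurable_Omega) => i; exact: (fe_v fe i).2.
  - by apply: integrable_sliceZ; exact: (fe_w fe).2.
  - apply: integrable_sliceZ; apply: integrable_sliceB; first exact: (fe_pow fe).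
    exact: (fe_rho fe).
have cV i : continuous (V i) by exact/smooth_continuous/(sV i).1.
have cW : continuous W by exact/smooth_continuous/sW.1.
have iM : integrable_slice t (fun a => rho a * (\sum_(i < 2) v i a * V i a)).
  exact: (@fe_dot _ _ _ (@mu_space R) _ _ measurable_Omega _ _ _ fe 2
    (fun i => slice (v i) t) (fun i => slice (V i) t) (fe_v fe)
    (fun i => sL2_continuous (cV i))).
have iN : integrable_slice t (fun a => rho a * w a * W a).
  apply: (@eq_integrable_slice _ _ (fun a => rho a * (w a * W a))).
    by move=> q _; rewrite mulrA.
  exact: (@fe_mul _ _ _ (@mu_space R) _ _ measurable_Omega _ _ _ fe _ _
    (fe_w fe) (sL2_continuous cW)).
have cpsi : continuous psi.
  by apply: smooth_continuous; exact: smooth_entropy_test.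
have iQ : integrable_slice t (fun a => rho a * psi a).
  exact: (@fe_int _ _ _ (@mu_space R) _ _ measurable_Omega _ _ _ fe _
    (sL2_continuous cpsi)).
have iS : integrable_slice t (fun a => clipped r c a `^ gamma).
  apply: (rint_continuous_Omega _ tT); apply: smooth_continuous.
  by apply: smooth_powR; [move=> a; exact: clipped_gt0|exact: smooth_clipped].
transitivity (int_Omega (fun a =>
   (2^-1 * rho a * (\sum_(i < 2) v i a ^+ 2) + epsilon ^+ 2 / 2 * rho a * w a ^+ 2
      + potential gamma (rho a))
   - rho a * (\sum_(i < 2) v i a * V i a) - epsilon ^+ 2 * (rho a * w a * W a)
   + rho a * psi a + clipped r c a `^ gamma) t); last first.
  have iN' := integrable_sliceZ (epsilon ^+ 2) iN.
  rewrite int_OmegaD//; last first.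
    by apply: integrable_sliceD => //; apply: integrable_sliceB => //; exact: integrable_sliceB.
  rewrite int_OmegaD//; last by apply: integrable_sliceB => //; exact: integrable_sliceB.
  rewrite int_OmegaB//; last exact: integrable_sliceB.
  by rewrite int_OmegaB// int_OmegaZ.
apply: eq_int_Omega => q Oq; rewrite /relative_energy_density /entropy_test.
have r0 : 0 < r (t, q) by apply: lt_trans (r_gt tT Oq).
rewrite derive1_potential// (potentialE gamma_gt1 (ltW r0)) (clippedE c_gt0 r_gt tT Oq).
rewrite density_identity//; congr (_ + _).
(* The remainder is [r P'(r) - P(r) = r^gamma]. *)
rewrite mulrCA mulr_powRB1 ?ltW// ?(lt_trans _ gamma_gt1)//.
by field.
Qed.

End relative_energy_slice.

(** * Identities between the space-time integrals *)

Section cylinder_identities.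
Context {R : realType}.
Variables (gamma epsilon T : R) (rho : spacetime R -> R)
  (v : 'I_2 -> spacetime R -> R) (w : spacetime R -> R)
  (Gv : 'I_2 -> 'I_3 -> spacetime R -> R) (Gw : 'I_3 -> spacetime R -> R)
  (r : spacetime R -> R) (V : 'I_2 -> spacetime R -> R)
  (W : spacetime R -> R) (c : R).
Hypotheses (gamma_gt1 : 1 < gamma) (c_gt0 : 0 < c).
Hypothesis r_gt : forall t q, t \in `[0, T] -> Omega q -> c < r (t, q).
Hypotheses (sr : smooth_periodic r) (zr : z_independent r)
  (sV : forall i, smooth_periodic (V i)) (sW : smooth_periodic W).
Variable tau : R.
Hypothesis tauT : tau \in `]0, T[.
Hypothesis fe : finite_energy (@mu_spacetime R) gamma (cylinder `]0, tau[) rho v w.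
Hypothesis LGv : forall i j,
  wL2 (@mu_spacetime R) (cylinder `]0, tau[) (fun=> 1) (Gv i j).
Hypothesis LGw : forall j,
  wL2 (@mu_spacetime R) (cylinder `]0, tau[) (fun=> 1) (Gw j).

Local Notation psi := (entropy_test gamma epsilon r V W c).

Let sub t : t \in `]0, tau[ -> t \in `[0, T].
Proof.
move: tauT; rewrite !in_itv/= => /andP[_ tT] /andP[t0 tt].
by rewrite ltW// ltW// (lt_trans tt).
Qed.

(** Splitting the product is legitimate because the weak gradient is square integrable and the
    derivatives of [V] are bounded on the cylinder. *)
Lemma dissipation_identity :
  int_cyl (fun a =>
        \sum_(i < 2) \sum_(j < 3) Gv i j a * (Gv i j a - ds j (V i) a)
        + epsilon ^+ 2 * (\sum_(j < 3) Gw j a ^+ 2)) tau =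
  int_cyl (fun a =>
        \sum_(i < 2) \sum_(j < 3) Gv i j a ^+ 2
        + epsilon ^+ 2 * (\sum_(j < 3) Gw j a ^+ 2)) tau
  - int_cyl (fun a => \sum_(i < 2) \sum_(j < 3) Gv i j a * ds j (V i) a) tau.
Proof.
have i2 G : wL2 (@mu_spacetime R) (cylinder `]0, tau[) (fun=> 1) G ->
    integrable_cyl tau (fun a => G a ^+ 2).
  move=> [_ iG]; apply: eq_integrable_cyl iG => t q _ _; exact: mul1r.
rewrite -int_cylB.
- apply: eq_int_cyl => t q _ _; rewrite addrAC -sumrB; congr (_ + _).
  apply: eq_bigr => i _; rewrite -sumrB; apply: eq_bigr => j _.
  by rewrite mulrBr expr2.
- apply: integrable_cylD.
    by apply: integrable_cyl_sum => i; apply: integrable_cyl_sum => j; exact: i2.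
  by apply: integrable_cylZ; apply: integrable_cyl_sum => j; exact: i2.
apply: integrable_cyl_sum => i; apply: integrable_cyl_sum => j.
apply: (@eq_integrable_cyl _ _ (fun a => 1 * (Gv i j a * ds j (V i) a))).
  by move=> t q _ _; rewrite mul1r.
have [mb [M bM]] := bounded_measurable_cylinder tau
  (smooth_continuous (smooth_derive (0, dir R j) (sV i).1)).
apply: (@wL2_mul _ _ _ (@mu_spacetime R) _ (measurable_cylinder _) (fun=> 1)) => //.
apply: (@wL2_bounded _ _ _ (@mu_spacetime R) _ (measurable_cylinder _) (fun=> 1) _ M) => //.
apply: (@rint_cst _ _ _ (@mu_spacetime R) _ (measurable_cylinder _)).
exact: mu_cylinder_fin.
Qed.

(** Once every integrand is known to be integrable, each side becomes a single integral and the
    claim reduces to [integrand_identity] at each point. *)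
Lemma transport_identity :
  int_cyl (fun a =>
     rho a * (\sum_(i < 2) material v w (V i) a * (V i a - v i a))) tau
  + epsilon ^+ 2 * int_cyl (fun a => rho a * material v w W a * (W a - w a)) tau
  - int_cyl (fun a =>
       derive1n 2 (potential gamma) (r a) *
       ((rho a - r a) * dt r a
        + rho a * (\sum_(i < 2) v i a * dx i r a))) tau =
  int_cyl (fun a => rho a * dt psi a
                        + rho a * (\sum_(i < 2) v i a * dx i psi a)
                        + rho a * w a * dz psi a) tau
  + int_cyl (dt (fun a => clipped r c a `^ gamma)) tau
  - int_cyl (fun a => rho a * (\sum_(i < 2) v i a * dt (V i) a)) tau
  - int_cyl (fun a =>
          rho a * (\sum_(i < 2) \sum_(j < 2) v i a * v j a * dx j (V i) a)
          + rho a * w a * (\sum_(i < 2) v i a * dz (V i) a)) tau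
  - epsilon ^+ 2 * int_cyl (fun a => rho a * w a * dt W a) tau
  - epsilon ^+ 2 * int_cyl (fun a =>
          rho a * w a * (\sum_(i < 2) v i a * dx i W a + w a * dz W a)) tau.
Proof.
have spsi : smooth psi by exact: smooth_entropy_test.
have scl : smooth (clipped r c) by exact: smooth_clipped.
have spow x : smooth (fun a => clipped r c a `^ x).
  by apply: smooth_powR => // a; exact: clipped_gt0.
have sD (e : spacetime R) f : smooth f -> smooth ('D_e f) by exact: smooth_derive.
have iB : integrable_cyl tau (fun a =>
    rho a * (\sum_(i < 2) material v w (V i) a * (V i a - v i a))).
  refine (cylL2_dot fe _ _) => i; first exact: (cylL2_material fe (sV i).1).
  by apply: (cylL2D fe); [exact: (cylL2_smooth fe (sV i).1)|
                          exact: (cylL2N (cylL2_v fe i))].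
have iC : integrable_cyl tau (fun a => rho a * material v w W a * (W a - w a)).
  apply: (@eq_integrable_cyl _ _ (fun a => rho a * (material v w W a * (W a - w a)))).
    by move=> t q _ _; rewrite mulrA.
  refine (cylL2_mul fe (cylL2_material fe sW.1) _).
  by apply: (cylL2D fe); [exact: (cylL2_smooth fe sW.1)|
                          exact: (cylL2N (cylL2_w fe))].
have iK : integrable_cyl tau (fun a => rho a * dt psi a
                        + rho a * (\sum_(i < 2) v i a * dx i psi a)
                        + rho a * w a * dz psi a).
  apply: (@eq_integrable_cyl _ _ (fun a => rho a * material v w psi a)).
    by move=> t q _ _; rewrite /material !mulrDr mulrA.
  exact: (cylL2_integrable fe (cylL2_material fe spsi)).
have iL : integrable_cyl tau (dt (fun a => clipped r c a `^ gamma)).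
  by apply: rint_continuous_cylinder; exact/smooth_continuous/sD.
have iI1 : integrable_cyl tau (fun a => rho a * (\sum_(i < 2) v i a * dt (V i) a)).
  refine (cylL2_dot fe (cylL2_v fe) _) => i; exact: (cylL2_smooth fe (sD _ _ (sV i).1)).
have iI2 : integrable_cyl tau (fun a =>
          rho a * (\sum_(i < 2) \sum_(j < 2) v i a * v j a * dx j (V i) a)
          + rho a * w a * (\sum_(i < 2) v i a * dz (V i) a)).
  apply: (@eq_integrable_cyl _ _ (fun a => rho a * (\sum_(i < 2)
     (\sum_(j < 2) v j a * dx j (V i) a + w a * dz (V i) a) * v i a))).
    by move=> t q _ _; exact: flux_identity.
  refine (cylL2_dot fe _ (cylL2_v fe)) => i.
  apply: (cylL2D fe); last exact: (cylL2M (cylL2_w fe) (sD _ _ (sV i).1)).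
  apply: (cylL2_sum fe) => j; exact: (cylL2M (cylL2_v fe j) (sD _ _ (sV i).1)).
have iJ1 : integrable_cyl tau (fun a => rho a * w a * dt W a).
  apply: (@eq_integrable_cyl _ _ (fun a => rho a * (w a * dt W a))).
    by move=> t q _ _; rewrite mulrA.
  exact: (cylL2_mul fe (cylL2_w fe) (cylL2_smooth fe (sD _ _ sW.1))).
have iJ2 : integrable_cyl tau (fun a =>
          rho a * w a * (\sum_(i < 2) v i a * dx i W a + w a * dz W a)).
  apply: (@eq_integrable_cyl _ _ (fun a =>
     rho a * (w a * (\sum_(i < 2) v i a * dx i W a + w a * dz W a)))).
    by move=> t q _ _; rewrite mulrA.
  refine (cylL2_mul fe (cylL2_w fe) _).
  apply: (cylL2D fe); last exact: (cylL2M (cylL2_w fe) (sD _ _ sW.1)).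
  apply: (cylL2_sum fe) => j; exact: (cylL2M (cylL2_v fe j) (sD _ _ sW.1)).
have rE t q : t \in `]0, tau[ -> Omega q -> clipped r c (t, q) = r (t, q).
  by move=> /sub tT Oq; exact: (clippedE c_gt0 r_gt tT Oq).
have rD e t q : t \in `]0, tau[ -> Omega q ->
    'D_e (clipped r c) (t, q) = 'D_e r (t, q).
  by move=> /sub tT Oq; exact: (clipped_derive c_gt0 r_gt sr e tT Oq).
have iD : integrable_cyl tau (fun a => derive1n 2 (potential gamma) (r a) *
       ((rho a - r a) * dt r a + rho a * (\sum_(i < 2) v i a * dx i r a))).
  pose p2 a := gamma * clipped r c a `^ (gamma - 2).
  have sp2 : smooth p2 by apply: smoothM; [exact: smooth_cst|exact: spow].
  apply: (@eq_integrable_cyl _ _ (fun a =>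
     rho a * ((dt r a + \sum_(i < 2) v i a * dx i r a) * p2 a)
     - p2 a * (r a * dt r a))).
    move=> t q tt Oq; rewrite derive1n2_potential//; last first.
      exact: lt_trans (r_gt (sub tt) Oq).
    by rewrite /p2 rE//; exact: pressure_identity.
  apply: integrable_cylB.
    apply: (cylL2_integrable fe); refine (cylL2M _ sp2).
    apply: (cylL2D fe); first exact: (cylL2_smooth fe (sD _ _ sr.1)).
    apply: (cylL2_sum fe) => j; exact: (cylL2M (cylL2_v fe j) (sD _ _ sr.1)).
  apply: rint_continuous_cylinder; apply: smooth_continuous.
  by apply: smoothM => //; apply: smoothM; [exact: sr.1|exact: (sD _ _ sr.1)].
have iC' := integrable_cylZ (epsilon ^+ 2) iC.
have iJ1' := integrable_cylZ (epsilon ^+ 2) iJ1.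
have iJ2' := integrable_cylZ (epsilon ^+ 2) iJ2.
have iBC := integrable_cylD iB iC'.
have iKL := integrable_cylD iK iL.
have iKL1 := integrable_cylB iKL iI1.
have iKL2 := integrable_cylB iKL1 iI2.
have iKL3 := integrable_cylB iKL2 iJ1'.
rewrite -(int_cylZ _ iC) -(int_cylZ _ iJ1) -(int_cylZ _ iJ2).
rewrite -(int_cylD iB iC') -(int_cylB iBC iD).
rewrite -(int_cylD iK iL) -(int_cylB iKL iI1) -(int_cylB iKL1 iI2).
rewrite -(int_cylB iKL2 iJ1') -(int_cylB iKL3 iJ2').
apply: eq_int_cyl => t q tt Oq.
have r0 : 0 < r (t, q) by exact: lt_trans (r_gt (sub tt) Oq).
(* One formula for all directions; inside the cylinder the clipped density and its derivatives are
   those of [r]. *)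
have DE e : 'D_e psi (t, q) = \sum_(i < 2) V i (t, q) * 'D_e (V i) (t, q)
    + epsilon ^+ 2 * (W (t, q) * 'D_e W (t, q))
    - gamma * r (t, q) `^ (gamma - 2) * 'D_e r (t, q).
  by rewrite (entropy_test_derive epsilon gamma_gt1 c_gt0 sr sV sW) rE// rD.
have FE : dt (fun a => clipped r c a `^ gamma) (t, q) =
    r (t, q) * (gamma * r (t, q) `^ (gamma - 2)) * dt r (t, q).
  by rewrite /dt (clipped_pow_derive gamma_gt1 c_gt0 sr) rE// rD.
have zr0 : 'D_(0, dir R vertical) r (t, q) = 0 by exact: dz_z_independent.
rewrite derive1n2_potential// FE.
have -> : dt psi (t, q) = _ := DE _.
have -> : dz psi (t, q) = _ := DE _.
rewrite zr0.
have -> : \sum_(i < 2) v i (t, q) * dx i psi (t, q) = 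
    \sum_(j < 2) v j (t, q) * (\sum_(i < 2) V i (t, q) * dx j (V i) (t, q) +
      epsilon ^+ 2 * (W (t, q) * dx j W (t, q)) -
      gamma * r (t, q) `^ (gamma - 2) * dx j r (t, q)).
  by apply: eq_bigr => j _; congr (_ * _); exact: DE.
exact: (integrand_identity (rho (t, q)) (w (t, q)) (W (t, q)) (dt W (t, q))
  (dz W (t, q)) (r (t, q)) (dt r (t, q)) _ _ (fun i => v i (t, q))
  (fun i => V i (t, q)) (fun i => dt (V i) (t, q)) (fun i => dz (V i) (t, q))
  (fun i => dx i W (t, q)) (fun i => dx i r (t, q))
  (fun i j => dx j (V i) (t, q))).
Qed.

End cylinder_identities.

Theorem lemma3p1 (R : realType) (gamma epsilon T : R)
    (hgamma : 1 < gamma) (hepsilon : 0 < epsilon) (hT : 0 < T)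
    (rho : spacetime R -> R) (v : 'I_2 -> spacetime R -> R)
    (w : spacetime R -> R)
    (Gv : 'I_2 -> 'I_3 -> spacetime R -> R) (Gw : 'I_3 -> spacetime R -> R)
    (rho0 : space3 R -> R) (v0 : 'I_2 -> space3 R -> R) (w0 : space3 R -> R)
    (hsol : dissipative_weak_solution gamma epsilon T rho v w Gv Gw rho0 v0 w0)
    (r : spacetime R -> R) (V : 'I_2 -> spacetime R -> R)
    (W : spacetime R -> R)
    (hr : smooth_periodic r) (hrz : z_independent r)
    (hr_gt0 : forall t q, t \in `[0, T] -> 0 < r (t, q))
    (hV : forall i, smooth_periodic (V i)) (hW : smooth_periodic W) :
  ae_time T (fun tau =>
    (relative_energy gamma epsilon rho v w r V W tau
     - relative_energy gamma epsilon rho v w r V W 0)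
    + int_cyl (fun a =>
        \sum_(i < 2) \sum_(j < 3) Gv i j a * (Gv i j a - ds j (V i) a)
        + epsilon ^+ 2 * (\sum_(j < 3) Gw j a ^+ 2)) tau
    <= int_cyl (fun a =>
         rho a * (\sum_(i < 2) material v w (V i) a * (V i a - v i a))) tau
       + epsilon ^+ 2 * int_cyl (fun a =>
           rho a * material v w W a * (W a - w a)) tau
       + epsilon ^+ 2 * int_cyl (fun a => \sum_(j < 3) Gw j a * ds j W a) tau
       - int_cyl (fun a =>
           derive1n 2 (potential gamma) (r a) *
           ((rho a - r a) * dt r a
            + rho a * (\sum_(i < 2) v i a * dx i r a))) tau
       - int_cyl (fun a => pressure gamma (rho a) * div_x V a) tau).
Proof.
have cr : continuous r := smooth_continuous hr.1.
have [c c0 r_gt] := positive_cylinder (ltW hT) cr hr_gt0.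
have spsi : smooth (entropy_test gamma epsilon r V W c).
  exact: smooth_entropy_test.
have ppsi : smooth_periodic (entropy_test gamma epsilon r V W c).
  split; [exact: spsi|exact: (periodic_entropy_test gamma epsilon c hr hV hW)].
have sF : smooth (fun a => clipped r c a `^ gamma).
  by apply: smooth_powR; [move=> a; exact: clipped_gt0|exact: smooth_clipped].
have T0 : 0 \in `[0, T] by rewrite in_itv/= lexx ltW.
have fe0 := finite_energy_init hgamma hT hsol.
(* All properties of [tau] are collected on one set of full measure, so the rest of the argument
   concerns a single time. *)
have eqns := ae_timeI (finite_energy_slice hgamma hsol)
  (ae_timeI (continuity_smooth hT hsol ppsi)
    (ae_timeI (momentum_h_smooth hT hsol hV)
      (ae_timeI (momentum_v_smooth hT hsol hW) (dws_energy hsol)))).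
apply: ae_timeS eqns => tau tauT [fe1 [cont [momh [momv energy]]]].
have /andP[tau0 ltT] : 0 < tau < T by rewrite in_itv/= in tauT.
have tau1 : tau \in `[0, T] by rewrite in_itv/= !ltW.
have fe := finite_energy_cylinder hgamma hsol (ltW ltT).
have LGv i j := gradient_L2 j (ltW ltT) (dws_v_H1 hsol i).
have LGw j := gradient_L2 j (ltW ltT) (dws_w_H1 hsol).
have press : int_cyl (fun a => pressure gamma (rho a) * dz W a) tau = 0.
  apply: int_cyl_dz_eq0 => //.
    by move=> t x1 x2 z z'; rewrite /pressure (dws_rho_z hsol t x1 x2 z z').
  have [mb [M bM]] := bounded_measurable_cylinder tau
    (smooth_continuous (smooth_derive (0, dir R vertical) hW.1)).
  exact: (@rintM _ _ _ (@mu_spacetime R) _ (measurable_cylinder _) _ _ M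
    (fe_pow fe) mb bM).
have E1 := relative_energyE epsilon hgamma c0 r_gt hr hV hW tau1 fe1.
have E0 := relative_energyE epsilon hgamma c0 r_gt hr hV hW T0 fe0.
have diss := dissipation_identity epsilon hV LGv LGw.
have transp := transport_identity epsilon hgamma c0 r_gt hr hrz hV hW tauT fe.
exact: (balance E1 E0 energy momh momv press cont (bracket_smooth tau0 sF) diss transp).
Qed.
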